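(* Let $(\mathbf{d}(n))_{n\in\mathbb{Z}^+}$ be a sparse asymptotic degree sequence with maximum degree $\Delta(n)\le n^{1/9}$ for every $n$, and let $L(s)=\sum_{i\ge 0}\lambda_i s^i$ be its generating polynomial. Suppose that $L$ is twice differentiable at $1$ (in the sense of left derivatives) and that $L''(1)>L'(1)$. Then $$p_c^{site}=p_c^{bond}=\frac{L'(1)}{L''(1)}.$$ Moreover, for bond percolation with any retention probability $p>p_c^{bond}$ there exists $\varepsilon>0$ such that $|L_1(G'(n))|>\varepsilon n$ with probability $1-o(1)$ as $n\to\infty$, where $G'(n)$ is the outcome of bond percolation on $G_n$; and likewise, for site percolation with any retention probability $p>p_c^{site}$ there exists $\varepsilon>0$ such that $|L_1(G'(n))|>\varepsilon n$ with probability $1-o(1)$ as $n\to\infty$, where $G'(n)$ is the outcome of site percolation on $G_n$.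
   Context: Degree sequences. Let $V_n=\{1,\dots,n\}$. A degree sequence on $V_n$ is a vector $\mathbf{d}=(d_1,\dots,d_n)$ of natural numbers ($0$ allowed) with $d_1\le\cdots\le d_n$ and $\sum_{i=1}^n d_i$ even. An asymptotic degree sequence is a sequence $(\mathbf{d}(n))_{n\in\mathbb{Z}^+}$ where $\mathbf{d}(n)$ is a degree sequence on $V_n$ for each $n$. Write $D_i(n)=|\{j\in V_n: d_j=i\}|$ for the number of vertices of degree $i$ in $\mathbf{d}(n)$ and $\Delta(n)=\max_{j} d_j=d_n$. The asymptotic degree sequence is sparse if for every $i\in\mathbb{N}$ (including $i=0$) the limit $\lim_{n\to\infty}D_i(n)/n=\lambda_i\in[0,1]$ exists, $\sum_{i\ge0}\lambda_i=1$, and $$\lim_{n\to\infty}\frac1n\sum_{i\ge1}i(i-2)D_i(n)=\sum_{i\ge1}i(i-2)\lambda_i<\infty.$$ Its generating polynomial is $L(s)=\sum_{i=0}^\infty\lambda_i s^i$. Standing assumption: for every $n$ there is at least one simple graph on $V_n$ in which vertex $j$ has degree $d_j$ for all $j$. Random graph. $G_n$ is chosen uniformly at random among all simple graphs on $V_n$ in which, for $j=1,\dots,n$, vertex $j$ has degree $d_j$, where $\mathbf{d}(n)=(d_1,\dots,d_n)$. Percolation with retention probability $p\in[0,1]$. Bond percolation: each edge of $G_n$ is retained with probability $p$ and deleted with probability $1-p$, independently of all other edges. Site percolation: each vertex of $G_n$ is, independently with probability $1-p$, made isolated (all edges incident to it are deleted; the vertex itself stays in the vertex set). In either case $G'(n)$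 is the resulting random spanning subgraph of $G_n$ on $V_n$. Probabilities are with respect to both levels of randomness (the choice of $G_n$ and the percolation). $L_1(G'(n))$ is the component of $G'(n)$ of maximum order (ties broken by taking the one containing the smallest vertex), and $|L_1(G'(n))|$ is its number of vertices. Critical probabilities. $p_c^{bond}=\sup\{p\in[0,1]: |L_1(G'(n))|/n\to0 \text{ in probability as } n\to\infty\}$, where $G'(n)$ is obtained by bond percolation with parameter $p$; $p_c^{site}$ is defined by the same formula with $G'(n)$ obtained by site percolation with parameter $p$. Here $X_n\to 0$ in probability means that $\mathbb{P}[|X_n|>\varepsilon]\to0$ as $n\to\infty$ for every $\varepsilon>0$. *)

(* Defs.v *)
From HB Require Import structures.
From mathcomp Require Import all_boot all_order all_algebra.
From mathcomp Require Import all_classical all_reals all_analysis.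

Set Implicit Arguments.
Unset Strict Implicit.
Unset Printing Implicit Defensive.

Import Order.TTheory GRing.Theory Num.Theory.
Import numFieldNormedType.Exports.

Local Open Scope classical_set_scope.
Local Open Scope ring_scope.

(* V_n = {1, ..., n} is encoded by 'I_n, and a sequence indexed by the positive
   integers by a family over nat whose term at n = 0 carries no information. *)

Definition degree_sequence n (d : n.-tuple nat) : bool :=
  sorted leq d && ~~ odd (\sum_(j < n) tnth d j).

Definition asymptotic_degree_sequence (d : forall n, n.-tuple nat) : Prop :=
  forall n, (0 < n)%N -> degree_sequence (d n).

Definition degree_count n (d : n.-tuple nat) (i : nat) : nat :=
  #|[set j : 'I_n | tnth d j == i]%SET|.

Definition max_degree n (d : n.-tuple nat) : nat := \max_(j < n) tnth d j.

(* The sum over i >= 1 of i(i-2)D_i(n) is cut at the maximum degree, past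
   which D_i(n) = 0. *)
Definition sparse (R : realType) (d : forall n, n.-tuple nat) (lam : nat -> R)
    : Prop :=
  [/\ forall i, 0 <= lam i <= 1 /\
        (degree_count (d n) i)%:R / n%:R @[n --> \oo] --> lam i,
      \sum_(0 <= i < k) lam i @[k --> \oo] --> (1 : R)
    & exists2 l : R,
        n%:R^-1 * (\sum_(1 <= i < (max_degree (d n)).+1)
                     i%:R * (i%:R - 2) * (degree_count (d n) i)%:R)
          @[n --> \oo] --> l
      & \sum_(1 <= i < k) i%:R * (i%:R - 2) * lam i @[k --> \oo] --> l].

(* Meaningful on [0, 1]; for s > 1 the series may diverge, whence the use of
   one-sided derivatives at 1 below. *)
Definition generating_function (R : realType) (lam : nat -> R) (s : R) : R :=
  limn (pseries lam s).

Definition left_derivable (R : realType) (f : R -> R) (x : R) : Prop :=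
  cvg ((f (x + h) - f x) / h @[h --> (0 : R)^'-]).

Definition left_derive (R : realType) (f : R -> R) (x : R) : R :=
  lim ((f (x + h) - f x) / h @[h --> (0 : R)^'-]).

Definition twice_left_derivable (R : realType) (f : R -> R) (x : R) : Prop :=
  [/\ \forall s \near x^'-, left_derivable f s,
      left_derivable f x
    & left_derivable (left_derive f) x].

(* A graph on 'I_n is given by its set of edges. *)
Notation graph n := {set {set 'I_n}}.

Definition simple n (E : graph n) : bool := [forall e in E, #|e| == 2].

Definition deg n (E : graph n) (v : 'I_n) : nat :=
  #|[set e in E | v \in e]%SET|.

Definition graphs_of n (d : n.-tuple nat) : {set graph n} :=
  [set E : graph n | simple E & [forall v, deg E v == tnth d v]]%SET.

Definition graphical (d : forall n, n.-tuple nat) : Prop :=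
  forall n, (0 < n)%N -> exists E : graph n, E \in graphs_of (d n).

Definition adj n (E : graph n) : rel 'I_n := fun u v => [set u; v]%SET \in E.

Definition component n (E : graph n) (v : 'I_n) : {set 'I_n} :=
  [set w | connect (adj E) v w]%SET.

(* v is the smallest vertex lying in a component of maximum order. *)
Definition first_in_largest n (E : graph n) (v : 'I_n) : bool :=
  [forall u, #|component E u| <= #|component E v|]%N &&
  [forall u : 'I_n, (u < v)%N ==> (#|component E u| < #|component E v|)%N].

(* The union has exactly one term when 0 < n. *)
Definition L1 n (E : graph n) : {set 'I_n} :=
  (\bigcup_(v | first_in_largest E v) component E v)%SET.

(* For each n and E : graph n, the probability mass function of the random
   subgraph of E. *)
Definition percolation (R : realType) :=
  forall n : nat, graph n -> graph n -> R.

Definition bond (R : realType) (p : R) : percolation R := fun n E F =>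
  if F \subset E then \prod_(e in E) (if e \in F then p else 1 - p) else 0.

(* S is the set of retained vertices. *)
Definition site (R : realType) (p : R) : percolation R := fun n E F =>
  \sum_(S : {set 'I_n} | [set e in E | e \subset S]%SET == F)
    \prod_(v < n) (if v \in S then p else 1 - p).

Definition prob (R : realType) (perc : percolation R) n (d : n.-tuple nat)
    (A : pred (graph n)) : R :=
  \sum_(E in graphs_of d)
    #|graphs_of d|%:R^-1 * \sum_(F : graph n | A F) perc n E F.

Definition L1_negligible (R : realType) (perc : percolation R)
    (d : forall n, n.-tuple nat) : Prop :=
  forall eps : R, 0 < eps ->
    prob perc (d n) [pred F | `|#|L1 F|%:R / n%:R| > eps]
      @[n --> \oo] --> (0 : R).

Definition L1_giant (R : realType) (perc : percolation R)
    (d : forall n, n.-tuple nat) : Prop :=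
  exists2 eps : R, 0 < eps &
    prob perc (d n) [pred F | #|L1 F|%:R > eps * n%:R] @[n --> \oo] --> (1 : R).

Definition critical_prob (R : realType) (perc : R -> percolation R)
    (d : forall n, n.-tuple nat) : R :=
  sup [set p : R | 0 <= p <= 1 /\ L1_negligible (perc p) d].

(* Main.v *)
(** The uniform simple graph with the given degrees is explored edge by edge
    while conditioning only on positive information, the event that a set H of
    already revealed edges is contained in the graph.  Edge switchings show
    that a further edge uw is then present with probability about r(u) r(w)
    over the sum of r, where r is the number of unrevealed edges at a vertex;
    no configuration model is needed since the squared maximum degree is o(n).

    Below the threshold, the expected number of percolated paths with j edges
    is at most about n (p L''(1) / L'(1))^j, and the square of the order of
    the largest component is at most the number of connected pairs.

    Above the threshold, a component is explored, restarting at a new root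
    whenever it dies out.  The number Y of unrevealed edges at the component
    under exploration has positive drift for the first delta n steps, so that
    exp (- theta Y) contracts at each step, and Y is linear in n at some time
    with exponentially small failure probability.  By uniform square
    integrability of the degrees, that component has linear order. *)
Require Import Defs.
From mathcomp Require Import all_boot all_order all_algebra.
From mathcomp Require Import all_classical all_reals all_analysis.
From mathcomp Require Import zify ring lra.
Import Order.TTheory GRing.Theory Num.Theory.
Import numFieldNormedType.Exports.
Local Open Scope classical_set_scope.
Local Open Scope ring_scope.

(** * Switchings in simple graphs *)

Section Switching.
Set Implicit Arguments.
Unset Strict Implicit.
Local Open Scope nat_scope.
Local Open Scope set_scope.
Local Open Scope bool_scope.

Variables (n : nat) (d : n.-tuple nat).
Implicit Types (G H D A : graph n) (u v w x y : 'I_n).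

(** Conditional probabilities are replaced by unnormalised sums over [completions H], so a history
    that no graph realises contributes zero and nothing has to be divided by its weight. Recording
    only present edges keeps the switchings simple: an edge of [H] merely must not be deleted,
    whereas a recorded absence would also restrict the edges that may be added. Coins are
    independent of the graph, so above the threshold both of their outcomes are recorded.

    Above the threshold the difficulty is that explorations die out again and again. The event to be
    excluded is that every component has total degree below [Y0]; under it Y stays below [Y0]
    through all restarts, so a single exponential estimate covers the whole run. Uniform square
    integrability is needed there a second time: a small linear number of visited vertices carries
    only a small part of the second moment, so the drift survives for linearly many steps. *)

Definition completions H : {set graph n} := [set G in graphs_of d | H \subset G].

(** The truncated subtraction is exact as soon as [completions H] is nonempty. *)
Definition residual H v : nat := tnth d v - deg H v.

Lemma degE G v : deg G v = \sum_(e in G) (v \in e).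
Proof. by rewrite /deg -sum1dep_card big_mkcondr. Qed.

Lemma degS {G H} : H \subset G -> forall v, deg H v <= deg G v.
Proof.
move=> HG v; apply/subset_leq_card/fintype.subsetP => e.
by rewrite !inE => /andP[/(fintype.subsetP HG) -> ->].
Qed.

Lemma degU G H v : [disjoint G & H] -> deg (G :|: H) v = deg G v + deg H v.
Proof.
by move=> GH; rewrite !degE -bigU //; apply: eq_bigl => e; rewrite !inE.
Qed.

Lemma deg_setD G H v : H \subset G -> deg (G :\: H) v = deg G v - deg H v.
Proof.
move=> HG; have {2}-> : G = (G :\: H) :|: H.
  apply/setP => e; rewrite !inE; have := fintype.subsetP HG e.
  by case: (e \in H) => [->|] //; rewrite orbF.
rewrite degU ?addnK // -setI_eq0; apply/eqP/setP => e; rewrite !inE.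
by case: (e \in H); rewrite ?andbF.
Qed.

Lemma completionsP H G :
  reflect [/\ simple G, forall v, deg G v = tnth d v & H \subset G]
          (G \in completions H).
Proof.
rewrite !inE -andbA; apply: (iffP and3P) => -[? Gd ?]; split=> //.
  by move=> v; apply/eqP/(forallP Gd).
by apply/forallP => v; rewrite Gd.
Qed.

Lemma in_set2_addn u v w : u != v -> (w \in [set u; v]) = (w == u) + (w == v) :> nat.
Proof.
move=> uv; rewrite !inE; case: eqP => [->|_] //=; case: eqP => // uv'.
by rewrite -uv' eqxx in uv.
Qed.

Lemma pair_inj u v w : [set u; v] = [set u; w] -> v = w.
Proof.
move=> E; have : v \in [set u; w] by rewrite -E !inE eqxx orbT.
rewrite !inE => /orP[/eqP vu|/eqP //].
have : w \in [set u; v] by rewrite E !inE eqxx orbT.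
by rewrite vu !inE orbb => /eqP.
Qed.

Lemma adjC G u v : adj G u v = adj G v u.
Proof. by rewrite /adj finset.setUC. Qed.

Lemma simple_adj {G} u v : simple G -> adj G u v -> u != v.
Proof. by move=> /forall_inP Gs /Gs; rewrite cards2; case: (u == v). Qed.

Lemma simpleS {G H} : H \subset G -> simple G -> simple H.
Proof.
by move=> HG /forall_inP Gs; apply/forall_inP => e /(fintype.subsetP HG)/Gs.
Qed.

Lemma sum_adj G u : simple G -> \sum_v adj G u v = deg G u.
Proof.
move=> Gs; transitivity #|[set v | adj G u v]|.
  by rewrite -sum1dep_card [RHS]big_mkcond.
rewrite -(card_in_imset (f := fun v => [set u; v])).
  congr #|pred_of_set _|; apply/setP => e; rewrite inE.
  apply/imsetP/andP => [[v]|[eG ue]].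
    by rewrite inE => uv ->; split=> //; rewrite !inE eqxx.
  have /cards2P[a [b [ab Ee]]] := forall_inP Gs e eG.
  move: ue; rewrite Ee !inE => /orP[]/eqP uE.
    by exists b; rewrite ?inE /adj uE // -Ee.
  by exists a; rewrite ?inE /adj uE finset.setUC // -Ee.
by move=> v w _ _; apply: pair_inj.
Qed.

Lemma sum_adjD H G u : G \in completions H ->
  \sum_v adj (G :\: H) u v = residual H u.
Proof.
case/completionsP => Gs Gd HG; rewrite sum_adj ?(deg_setD _ HG) ?Gd //.
exact: simpleS (finset.subsetDl _ _) Gs.
Qed.

(** Removing [A] and restoring [D] undoes the switching. Hence a map that switches and keeps the
    record of the chosen vertices is injective. *)
Lemma switch_inj G1 G2 D A : D \subset G1 -> D \subset G2 ->
  [disjoint A & G1] -> [disjoint A & G2] ->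
  (G1 :\: D) :|: A = (G2 :\: D) :|: A -> G1 = G2.
Proof.
have key G : D \subset G -> [disjoint A & G] ->
    (((G :\: D) :|: A) :\: A) :|: D = G.
  move=> DG AG; apply/setP => e; rewrite !inE.
  case eD: (e \in D); first by rewrite (fintype.subsetP DG e eD) orbT.
  by case eA: (e \in A); [rewrite (disjointFr AG eA)|rewrite /= !orbF].
by move=> D1 D2 A1 A2 E; rewrite -(key _ D1 A1) E key.
Qed.

Lemma switch_completions H G D A : G \in completions H ->
    D \subset G -> [disjoint D & H] -> [disjoint A & G] -> simple A ->
    (forall v, deg D v = deg A v) ->
  (G :\: D) :|: A \in completions H.
Proof.
move=> /completionsP[Gs Gd HG] DG DH AG As DA; apply/completionsP; split.
- apply/forall_inP => e; rewrite !inE => /orP[/andP[_]|]; apply/forall_inP: e => //.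
- move=> v; rewrite degU; last first.
    by rewrite disjoint_sym; apply: disjointWr AG; apply: finset.subsetDl.
  by rewrite deg_setD // -DA subnK // degS.
- apply/fintype.subsetP => e eH; rewrite !inE (fintype.subsetP HG) // andbT.
  by rewrite (disjointFl DH eH).
Qed.

End Switching.

(** * Double counting of switchings *)

Section SwitchingBounds.
Set Implicit Arguments.
Unset Strict Implicit.
Local Open Scope nat_scope.
Local Open Scope set_scope.
Local Open Scope bool_scope.

Variables (n : nat) (d : n.-tuple nat).
Implicit Types (G H D A : graph n) (u v w x y : 'I_n).
Local Notation completions := (completions d).
Local Notation residual := (residual d).

Lemma card_triples (T I J : finType) (C : {set T}) (P : T -> I -> J -> bool) :
  #|[set z : T * (I * J) | (z.1 \in C) && P z.1 z.2.1 z.2.2]|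
  = \sum_(t in C) \sum_i \sum_j P t i j.
Proof.
transitivity (\sum_(t in C) \sum_(b | P t b.1 b.2) 1).
  by rewrite pair_big_dep -sum1dep_card.
apply: eq_bigr => t _; rewrite pair_big /= big_mkcond /=.
by apply: eq_bigr.
Qed.

Lemma leq_sum_adj G (B : pred 'I_n) Delta : simple G ->
  (forall v, deg G v <= Delta) ->
  \sum_x \sum_y B x * adj G x y <= #|B| * Delta.
Proof.
move=> Gs GD; rewrite -sum1_card big_distrl /= [leqRHS]big_mkcond /=.
apply: leq_sum => x _; rewrite -big_distrr /= sum_adj // unfold_in.
by case: (B x); rewrite ?mul1n.
Qed.

Lemma leq_sum_adjr G (B : pred 'I_n) Delta : simple G ->
  (forall v, deg G v <= Delta) ->
  \sum_x \sum_y B y * adj G x y <= #|B| * Delta.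
Proof.
move=> Gs GD; rewrite exchange_big /=.
by under eq_bigr do under eq_bigr do rewrite adjC; apply: leq_sum_adj.
Qed.

Lemma card_closed_nbhd G u Delta : simple G -> deg G u <= Delta ->
  #|[pred x | (x == u) || adj G u x]| <= Delta.+1.
Proof.
move=> Gs Gu; rewrite -add1n; apply: (@leq_trans (#|pred1 u| + #|adj G u|)).
  by rewrite -cardUI leq_addr.
rewrite card1 leq_add2l (leq_trans _ Gu) // -sum_adj // -sum1_card [leqLHS]big_mkcond.
by apply: leq_sum => v _; rewrite -[v \in _]/(adj G u v); case: (adj G u v).
Qed.

Lemma completionsU1 H G e : (G \in completions (e |: H)) = (G \in completions H) && (e \in G).
Proof.
by rewrite !inE finset.subUset finset.sub1set; case: (e \in G); rewrite ?andbT ?andbF.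
Qed.

(* Switching: delete [uw] and [xy], add [ux] and [wy]. *)
Lemma switch_upper H u w Delta : u != w -> [set u; w] \notin H ->
    (forall v, tnth d v <= Delta) ->
  #|completions ([set u; w] |: H)| * \sum_v residual H v
  <= #|completions H| * (residual H u * residual H w)
     + #|completions ([set u; w] |: H)| * (2 * (Delta.+1 * Delta)).
Proof.
move=> uw uwH dD.
(* Valid choices: the added pairs are neither loops nor edges of [G]. *)
pose P G x y := [&& adj (G :\: H) x y, ~~ ((x == u) || adj G u x)
                  & ~~ ((y == w) || adj G w y)].
pose Q G x y := adj (G :\: H) u x && adj (G :\: H) w y.
pose X := [set z : graph n * ('I_n * 'I_n) |
  (z.1 \in completions ([set u; w] |: H)) && P z.1 z.2.1 z.2.2].
pose Y := [set z : graph n * ('I_n * 'I_n) |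
  (z.1 \in completions H) && Q z.1 z.2.1 z.2.2].
pose Del (z : graph n * ('I_n * 'I_n)) : graph n := [set [set u; w]; [set z.2.1; z.2.2]].
pose Add (z : graph n * ('I_n * 'I_n)) : graph n := [set [set u; z.2.1]; [set w; z.2.2]].
pose f z : graph n * ('I_n * 'I_n) := ((z.1 :\: Del z) :|: Add z, z.2).
have DelG z : z \in X -> Del z \subset z.1.
  rewrite inE completionsU1 => /andP[/andP[zC uwG]]; rewrite /P /adj inE.
  by case/and3P => /andP[_ xyG] _ _; rewrite finset.subUset !finset.sub1set uwG xyG.
have AddG z : z \in X -> [disjoint Add z & z.1].
  rewrite inE /P => /andP[_ /and3P[_ xu yw]]; rewrite finset.disjoints_subset finset.subUset.
  rewrite !finset.sub1set !inE; move: xu yw; rewrite !negb_or => /andP[_ xu] /andP[_ yw].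
  exact/andP.
have XY : #|X| <= #|Y|.
  rewrite -(card_in_imset (f := f)); last first.
    move=> [G [x y]] [G' [x' y']] zX zX' [E Ex Ey]; subst x' y'.
    congr (_, _).
    exact: (@switch_inj _ G G' (Del (G, (x, y))) (Add (G, (x, y)))
      (DelG _ zX) (DelG _ zX') (AddG _ zX) (AddG _ zX') E).
  apply/subset_leq_card/fintype.subsetP => _ /imsetP[[G [x y]] zX ->].
  have := zX; rewrite inE completionsU1 /= => /andP[/andP[GC uwG]] /and3P[].
  rewrite {1}/adj inE !negb_or => /andP[xyH xyG] /andP[xu uxG] /andP[yw wyG].
  have [Gs Gd HG] := completionsP _ _ _ GC.
  have xy := simple_adj Gs xyG.
  have wx : x != w by apply: contraNneq uxG => ->.
  have uy : y != u by apply: contraNneq wyG => ->; rewrite adjC.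
  have uxH : [set u; x] \notin H by apply: contra uxG => /(fintype.subsetP HG).
  have wyH : [set w; y] \notin H by apply: contra wyG => /(fintype.subsetP HG).
  rewrite inE /= /Q /adj; apply/andP; split.
    apply: switch_completions GC (DelG _ zX) _ (AddG _ zX) _ _.
    - by rewrite finset.disjoints_subset finset.subUset !finset.sub1set !inE /= uwH xyH.
    - apply/forall_inP => e; rewrite !inE => /orP[]/eqP->; rewrite cards2 /=.
        by rewrite (eq_sym u) xu.
      by rewrite (eq_sym w) yw.
    have ne1 : [set u; x] != [set w; y].
      apply: contraNneq uw => E; have := set21 u x; rewrite E !inE.
      by rewrite (eq_sym u y) (negbTE uy) orbF => /eqP ->.
    have ne2 : [set u; w] != [set x; y].
      apply: contraNneq uxG => E; have := set21 u w; rewrite E !inE.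
      by rewrite !(eq_sym u) (negbTE xu) (negbTE uy).
    move=> v; rewrite !degE !big_setU1 ?finset.in_set1 // !big_set1.
    have ux : u != x by rewrite eq_sym.
    have wy : w != y by rewrite eq_sym.
    rewrite (in_set2_addn v uw) (in_set2_addn v xy) (in_set2_addn v ux).
    by rewrite (in_set2_addn v wy); exact: addnACA.
  by rewrite !inE !eqxx uxH wyH !orbT.
have XE : #|X| = \sum_(G in completions ([set u; w] |: H)) \sum_x \sum_y P G x y.
  exact: card_triples.
have YE : #|Y| = #|completions H| * (residual H u * residual H w).
  rewrite [LHS]card_triples -sum_nat_const; apply: eq_bigr => G GC.
  rewrite -(sum_adjD u GC) -(sum_adjD w GC) big_distrl /=; apply: eq_bigr => x _.
  by rewrite big_distrr; apply: eq_bigr => y _ /=; rewrite mulnb.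
rewrite -YE; apply: leq_trans (leq_add XY (leqnn _)); rewrite XE -!sum_nat_const.
rewrite -big_split; apply: leq_sum => G; rewrite completionsU1 => /andP[GC uwG].
have [Gs Gd HG] := completionsP _ _ _ GC.
have GD v : deg G v <= Delta by rewrite Gd.
pose B u : pred 'I_n := [pred x | (x == u) || adj G u x].
(* An invalid ordered edge [xy] has [x] in the closed neighbourhood of [u] or [y] in that of [w];
   each case accounts for at most [Delta.+1 * Delta] ordered edges. *)
apply: (@leq_trans (\sum_x \sum_y P G x y + (\sum_x \sum_y B u x * adj G x y
   + \sum_x \sum_y B w y * adj G x y))).
  rewrite -!big_split /=; apply: leq_sum => x _.
  rewrite -(sum_adjD x GC) -!big_split /=; apply: leq_sum => y _.
  have -> : P G x y = [&& adj (G :\: H) x y, ~~ B u x & ~~ B w y] by [].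
  have -> : adj (G :\: H) x y = ([set x; y] \notin H) && adj G x y by rewrite /adj inE.
  by case: (B u x) (B w y) (adj G x y) (_ \notin H) => [] [] [] [].
rewrite leq_add2l mul2n -addnn leq_add //.
  apply: leq_trans (leq_sum_adj _ Gs GD) _.
  by rewrite leq_mul2r card_closed_nbhd ?orbT.
apply: leq_trans (leq_sum_adjr _ Gs GD) _.
by rewrite leq_mul2r card_closed_nbhd ?orbT.
Qed.

(* Switching: delete [ux], [wy] and [ab], add [uw], [xa] and [yb]. The third
   edge makes the number of valid choices almost independent of the graph, which
   fails for the inverse of the previous switching when [u] and [w] have
   degree 1. *)
Lemma switch_lower H u w Delta : u != w -> [set u; w] \notin H ->
    (forall v, tnth d v <= Delta) ->
  #|completions H| * (residual H u * residual H w) * \sum_v residual H v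
  <= #|completions ([set u; w] |: H)|
       * ((\sum_v residual H v) ^ 2 + residual H u * residual H w * \sum_v residual H v)
     + #|completions H| * (residual H u * residual H w) * (2 * (Delta.+2 * Delta)).
Proof.
move=> uw uwH dD.
pose C := [set G in completions H | [set u; w] \notin G].
pose P0 G (p : 'I_n * 'I_n) := adj (G :\: H) u p.1 && adj (G :\: H) w p.2.
(* Excluding [q.1 == p.2] keeps the added edges [xa] and [yb] distinct; the other exclusions keep
   them from being loops or edges of [G]. *)
pose P1 G (p q : 'I_n * 'I_n) :=
  [&& adj (G :\: H) q.1 q.2, ~~ [|| q.1 == p.2, q.1 == p.1 | adj G p.1 q.1]
    & ~~ ((q.2 == p.2) || adj G p.2 q.2)].
pose Q G (p q : 'I_n * 'I_n) := adj (G :\: H) p.1 q.1 && adj (G :\: H) p.2 q.2.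
pose T := (graph n * (('I_n * 'I_n) * ('I_n * 'I_n)))%type.
pose X := [set z : T | (z.1 \in C) && (P0 z.1 z.2.1 && P1 z.1 z.2.1 z.2.2)].
pose Y := [set z : T |
  (z.1 \in completions ([set u; w] |: H)) && Q z.1 z.2.1 z.2.2].
pose Del (z : T) : graph n := [set [set u; z.2.1.1]; [set w; z.2.1.2]; [set z.2.2.1; z.2.2.2]].
pose Add (z : T) : graph n := [set [set u; w]; [set z.2.1.1; z.2.2.1]; [set z.2.1.2; z.2.2.2]].
pose f z : T := ((z.1 :\: Del z) :|: Add z, z.2).
have DelG z : z \in X -> Del z \subset z.1.
  rewrite inE /P0 /P1 /adj !inE => /andP[_ /andP[/andP[]]].
  move=> /andP[_ H1] /andP[_ H2] /and3P[/andP[_ H3] _ _].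
  by rewrite !finset.subUset !finset.sub1set H1 H2 H3.
have AddG z : z \in X -> [disjoint Add z & z.1].
  rewrite inE inE => /andP[/andP[_ H1]] /andP[_ /and3P[_]].
  rewrite !negb_or => /and3P[_ _ H2] /andP[_ H3].
  by rewrite finset.disjoints_subset !finset.subUset !finset.sub1set !finset.in_setC H1 H2.
have XY : #|X| <= #|Y|.
  rewrite -(card_in_imset (f := f)); last first.
    move=> [G [[x y] [a b]]] [G' [[x' y'] [a' b']]] zX zX' [E Ex Ey Ea Eb]; subst x' y' a' b'.
    congr (_, _).
    exact: (@switch_inj _ G G' (Del (G, ((x, y), (a, b)))) (Add (G, ((x, y), (a, b))))
      (DelG _ zX) (DelG _ zX') (AddG _ zX) (AddG _ zX') E).
  apply/subset_leq_card/fintype.subsetP => _ /imsetP[[G [[x y] [a b]]] zX ->].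
  have := zX; rewrite inE [(_, _).1 \in C]inE /P0 /P1 /= => /andP[/andP[GC uwG]].
  rewrite {1 2 3}/adj !finset.in_setD !negb_or => /andP[/andP[/andP[uxH uxG] /andP[wyH wyG]]].
  case/and3P=> /andP[abH abG] /and3P[ay ax xaG] /andP[bny ybG].
  have [Gs Gd HG] := completionsP _ _ _ GC.
  have ux := simple_adj Gs uxG.
  have wy := simple_adj Gs wyG.
  have ab := simple_adj Gs abG.
  have xa : x != a by rewrite eq_sym.
  have yb : y != b by rewrite eq_sym.
  have xw : x != w by apply: contraNneq uwG => <-.
  have yu : y != u by apply: contraNneq uwG => <-; rewrite finset.setUC.
  have xaH : [set x; a] \notin H by apply: contra xaG => /(fintype.subsetP HG).
  have ybH : [set y; b] \notin H by apply: contra ybG => /(fintype.subsetP HG).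
  rewrite inE completionsU1 /Q /= /adj -andbA; apply/and3P; split; last 2 first.
  - by rewrite !inE !eqxx !orbT.
  - by rewrite !inE !eqxx xaH ybH !orbT.
  apply: switch_completions GC (DelG _ zX) _ (AddG _ zX) _ _.
  - rewrite finset.disjoints_subset !finset.subUset !finset.sub1set !finset.in_setC.
    by rewrite uxH wyH abH.
  - apply/forall_inP => e; rewrite !inE => /orP[/orP[]|]/eqP->; rewrite cards2 /=.
    + by rewrite uw.
    + by rewrite xa.
    + by rewrite yb.
  have D1 : [set u; x] != [set w; y].
    apply: contraNneq uw => E; have := set21 u x; rewrite E !inE.
    by rewrite (eq_sym u y) (negbTE yu) orbF => /eqP ->.
  have D2 : [set u; x] != [set a; b].
    apply: contraNneq xaG => E; have := set21 a b; rewrite -E !inE.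
    by rewrite (negbTE ax) orbF => /eqP ->; rewrite adjC.
  have D3 : [set w; y] != [set a; b].
    apply: contraNneq ybG => E; have := set22 a b; rewrite -E !inE.
    by rewrite (negbTE bny) orbF => /eqP ->; rewrite adjC.
  have A1 : [set u; w] != [set x; a].
    apply: contraNneq xaG => E; have := set21 x a; rewrite -E !inE.
    by rewrite (negbTE xw) (eq_sym x) (negbTE ux).
  have A2 : [set u; w] != [set y; b].
    apply: contraNneq ybG => E; have := set21 y b; rewrite -E !inE.
    by rewrite (negbTE yu) (eq_sym y) (negbTE wy).
  have A3 : [set x; a] != [set y; b].
    apply: contraNneq ab => E; have := set22 x a; rewrite E !inE.
    by rewrite (negbTE ay) => /eqP ->.
  move=> v; rewrite /Del /Add /= -!finset.setUA.
  have M1 : [set u; x] \notin [set [set w; y]; [set a; b]].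
    by rewrite !inE negb_or D1 D2.
  have M2 : [set u; w] \notin [set [set x; a]; [set y; b]].
    by rewrite !inE negb_or A1 A2.
  rewrite !degE !big_setU1 ?finset.in_set1 // !big_set1 /=.
  rewrite (in_set2_addn v uw) (in_set2_addn v xa) (in_set2_addn v yb).
  rewrite (in_set2_addn v ux) (in_set2_addn v wy) (in_set2_addn v ab).
  move: (v == u) (v == x) (v == w) (v == y) (v == a) (v == b) => b1 b2 b3 b4 b5 b6.
  by clear; lia.
have XE : #|X| = \sum_(G in C) \sum_p \sum_q (P0 G p && P1 G p q).
  exact: (card_triples _ (fun G p q => P0 G p && P1 G p q)).
have YE : #|Y| = #|completions ([set u; w] |: H)| * (\sum_v residual H v) ^ 2.
  rewrite [LHS](card_triples _ Q) -sum_nat_const; apply: eq_bigr => G.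
  rewrite completionsU1 => /andP[GC _].
  transitivity (\sum_x \sum_y \sum_a \sum_b adj (G :\: H) x a * adj (G :\: H) y b).
    rewrite [RHS]pair_big /=; apply: eq_bigr => p _; rewrite pair_big /=.
    by apply: eq_bigr => q _; rewrite mulnb.
  rewrite expnS expn1 big_distrl /=; apply: eq_bigr => x _.
  rewrite big_distrr /=; apply: eq_bigr => y _.
  rewrite -(sum_adjD x GC) -(sum_adjD y GC) big_distrl /=; apply: eq_bigr => a _.
  by rewrite big_distrr.
have P0E G : G \in completions H -> \sum_p P0 G p = residual H u * residual H w.
  move=> GC; rewrite -(sum_adjD u GC) -(sum_adjD w GC) big_distrl /=.
  under [RHS]eq_bigr do rewrite big_distrr /=.
  by rewrite pair_big /=; apply: eq_bigr => p _; rewrite mulnb.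
set m := \sum_v residual H v; set r := residual H u * residual H w.
have XC : #|C| * (r * m) <= #|X| + #|C| * (r * (2 * (Delta.+2 * Delta))).
  rewrite XE -!sum_nat_const -big_split /=; apply: leq_sum => G; rewrite inE => /andP[GC uwG].
  rewrite /r -(P0E _ GC) !big_distrl /= -big_split /=; apply: leq_sum => p _.
  case: (P0 G p) => //=; rewrite !mul1n.
  have [Gs Gd HG] := completionsP _ _ _ GC.
  have GD v : deg G v <= Delta by rewrite Gd.
  pose B1 : pred 'I_n := [pred a | (a == p.2) || ((a == p.1) || adj G p.1 a)].
  pose B2 : pred 'I_n := [pred b | (b == p.2) || adj G p.2 b].
  apply: (@leq_trans (\sum_q P1 G p q + (\sum_x \sum_y B1 x * adj G x y
     + \sum_x \sum_y B2 y * adj G x y))).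
    rewrite !pair_big /= -!big_split /= /m.
    have -> : \sum_v residual H v = \sum_x \sum_y adj (G :\: H) x y.
      by apply: eq_bigr => x _; rewrite (sum_adjD x GC).
    rewrite pair_big; apply: leq_sum => q _.
    have -> : P1 G p q = [&& adj (G :\: H) q.1 q.2, ~~ B1 q.1 & ~~ B2 q.2] by [].
    have -> : adj (G :\: H) q.1 q.2 = ([set q.1; q.2] \notin H) && adj G q.1 q.2.
      by rewrite /adj inE.
    by case: (B1 q.1) (B2 q.2) (adj G q.1 q.2) (_ \notin H) => [] [] [] [].
  rewrite leq_add2l mul2n -addnn leq_add //.
    apply: leq_trans (leq_sum_adj _ Gs GD) _; rewrite leq_mul2r orbC.
    have := card_closed_nbhd Gs (GD p.1).
    set k := #|_| => kD; apply/orP; left; apply: (@leq_trans (1 + k)) => //.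
    by rewrite -(card1 p.2) /k -cardUI leq_addr.
  apply: leq_trans (leq_sum_adjr _ Gs GD) _.
  by rewrite leq_mul2r (leq_trans (card_closed_nbhd Gs (GD p.2))) ?orbT.
(* Completions that already contain [uw] are not switched; they produce the term of order [r * m]
   beside [m ^ 2] in the bound. *)
have CE : #|completions H| = #|completions ([set u; w] |: H)| + #|C|.
  rewrite -(cardsID [set G : graph n | [set u; w] \in G] (completions H)); congr addn; apply: eq_card => G.
    by rewrite completionsU1 finset.in_setI (finset.in_set (fun G => _ \in G)).
  by rewrite finset.in_setD !finset.in_set andbC.
rewrite YE -/m in XY; rewrite CE; move: XC XY; set c := 2 * _.
move: #|X| #|C| #|completions ([set u; w] |: H)| m r c; clear.
by move=> x y z m r c; rewrite -mulnn; lia.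
Qed.

End SwitchingBounds.

(** * Percolation from independent coins *)

Section Coins.
Set Implicit Arguments.
Unset Strict Implicit.
Local Open Scope set_scope.
Local Open Scope bool_scope.

Variables (R : realType) (p : R).

(** In use, [T] is the type of all vertex sets, so that one coin space holds the coins of edges
    (pairs) and of vertices (singletons). Coins that are never consulted sum out to 1. *)
Definition coin_weight (T : finType) (S : {set T}) : R :=
  \prod_c (if c \in S then p else 1 - p).

Lemma sum_coin_weight_cylinder (T : finType) (O S0 : {set T}) : S0 \subset O ->
  \sum_(S | S :&: O == S0) coin_weight S
  = \prod_(c in O) (if c \in S0 then p else 1 - p).
Proof.
move=> /fintype.subsetP S0O.
(* Weights of heads and tails, set to 0 on [O] where they contradict [S0]; expanding the product of
   [f c + g c] leaves exactly the cylinder. *)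
pose f c := if c \in O then (if c \in S0 then p else 0) else p.
pose g c := if c \in O then (if c \in S0 then 0 else 1 - p) else 1 - p.
transitivity (\prod_c (f c + g c)); last first.
  rewrite [RHS]big_mkcond; apply: eq_bigr => c _; rewrite /f /g.
  by case: (c \in O); case: (c \in S0); rewrite ?addr0 ?add0r // addrC subrK.
rewrite bigA_distr /= big_mkcond /=; apply: eq_bigr => S _; case: ifPn => [/eqP E|].
  apply: eq_bigr => c _; rewrite /f /g -E inE.
  by case: (c \in O); case: (c \in S).
move=> SO; suff [c cO cS] : exists2 c, c \in O & (c \in S) != (c \in S0).
  rewrite (bigD1 c) //= /f /g cO; move: cS.
  by case: (c \in S); case: (c \in S0) => //=; rewrite mul0r.
apply/exists_inP; apply: contraNT SO => /exists_inPn SO.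
apply/eqP/setP => c; rewrite inE; case cO: (c \in O); rewrite ?andbT ?andbF.
  by apply/eqP; have := SO c cO; rewrite negbK.
by apply/esym/negbTE/negP => /S0O; rewrite cO.
Qed.

Lemma sum_coin_weight (T : finType) : \sum_(S : {set T}) coin_weight S = 1.
Proof.
have := sum_coin_weight_cylinder (finset.sub0set (finset.set0 : {set T})).
rewrite big_set0 => <-; apply: eq_bigl => S.
by rewrite finset.setI0 eqxx.
Qed.

Lemma sum_coin_weight_superset (T : finType) (Z : {set T}) :
  \sum_(S : {set T} | Z \subset S) coin_weight S = p ^+ #|Z|.
Proof.
transitivity (\prod_(c in Z) (if c \in Z then p else 1 - p)); last first.
  by rewrite -prodr_const; apply: eq_bigr => c ->.
rewrite -(sum_coin_weight_cylinder (subxx Z)); apply: eq_bigl => S.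
by rewrite finset.setIC; apply/finset.setIidPl/eqP.
Qed.

Lemma coin_weight_ge0 (T : finType) (S : {set T}) : 0 <= p <= 1 -> 0 <= coin_weight S.
Proof.
move=> /andP[p0 p1]; apply: prodr_ge0 => c _.
by case: ifP; rewrite ?subr_ge0.
Qed.

Variable n : nat.
Implicit Types (G F S : graph n).

Definition bond_graph G S : graph n := G :&: S.

(* The coin of a vertex [v] is attached to the singleton [set v]. *)
Definition site_graph G S : graph n := [set e in G | [forall v in e, [set v] \in S]].

Lemma bond_coins G F : bond p G F = \sum_(S | bond_graph G S == F) coin_weight S.
Proof.
rewrite /bond; case: ifPn => FG.
  rewrite -(sum_coin_weight_cylinder FG); apply: eq_bigl => S.
  by rewrite finset.setIC.
rewrite big_pred0 // => S; apply: contraNF FG => /eqP <-.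
exact: finset.subsetIl.
Qed.

Lemma site_coins G F : site p G F = \sum_(S | site_graph G S == F) coin_weight S.
Proof.
pose vtx S := [set v : 'I_n | [set v] \in S].
have siteE S : site_graph G S = [set e in G | e \subset vtx S].
  apply/setP => e; rewrite !inE; congr (_ && _).
  by apply/forall_inP/fintype.subsetP => eS v /eS; rewrite ?inE.
rewrite [RHS](partition_big vtx
  (fun U => [set e in G | e \subset U] == F)) /=; last by move=> S; rewrite siteE.
apply: eq_bigr => U GU.
pose O : graph n := [set [set v] | v in 'I_n].
have UO : [set [set v] | v in U] \subset O by apply: imsetS; apply/fintype.subsetP.
transitivity (\sum_(S | S :&: O == [set [set v] | v in U]) coin_weight S).
  rewrite (sum_coin_weight_cylinder UO) /O big_imset /=; last first.
    by move=> u v _ _; apply: finset.set1_inj.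
  by apply: eq_big => // v _; rewrite mem_imset //; apply: finset.set1_inj.
apply: eq_bigl => S; apply/eqP/andP => [E|[_ /eqP <-]].
  have vS : vtx S = U.
    apply/setP => v; rewrite inE -(mem_imset U v (@finset.set1_inj _)) -E inE.
    by rewrite /O imset_f ?andbT.
  by rewrite siteE vS.
apply/setP => e; rewrite inE; apply/andP/imsetP => [[eS /imsetP[v _ ev]]|[v]].
  by exists v; rewrite // inE -ev.
by rewrite inE => vS ->; rewrite vS imset_f.
Qed.

(** A percolation law that is an image of the coin weights turns probabilities into sums over
    independent pairs of a graph and a coin set, the form in which edges and coins can be revealed
    one at a time. *)
Lemma prob_coins (perc : percolation R) (F : graph n -> graph n -> graph n)
    (d : n.-tuple nat) (A : pred (graph n)) :
  (forall G X, perc n G X = \sum_(S | F G S == X) coin_weight S) ->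
  prob perc d A = #|graphs_of d|%:R^-1
    * \sum_(G in graphs_of d) \sum_S (A (F G S))%:R * coin_weight S.
Proof.
move=> percE; rewrite /prob -mulr_sumr; congr (_ * _); apply: eq_bigr => G _.
under eq_bigr do rewrite percE.
rewrite [RHS](bigID (fun S => A (F G S))) /= [X in _ = _ + X]big1 ?addr0; last first.
  by move=> S /negbTE ->; rewrite mul0r.
rewrite [RHS](partition_big (F G) A) //=; apply: eq_bigr => X AX.
apply: eq_big => [S|S /eqP ->]; last by rewrite AX mul1r.
by case: eqP => [->|_]; rewrite ?AX ?andbF.
Qed.

End Coins.

(** * The order of the largest component *)

Section LargestComponent.
Set Implicit Arguments.
Unset Strict Implicit.
Local Open Scope nat_scope.
Local Open Scope set_scope.
Local Open Scope bool_scope.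

Variable n : nat.
Implicit Types (E : graph n) (u v : 'I_n).

Lemma first_in_largest_inj E u v :
  first_in_largest E u -> first_in_largest E v -> u = v.
Proof.
move=> /andP[/forallP u1 /forallP u2] /andP[/forallP v1 /forallP v2].
apply/val_inj; case: (ltngtP (val u) (val v)) => // uv.
  by have := implyP (v2 u) uv; rewrite ltnNge u1.
by have := implyP (u2 v) uv; rewrite ltnNge v1.
Qed.

Lemma L1_component E v : first_in_largest E v -> L1 E = component E v.
Proof.
move=> Ev; rewrite /L1 (bigD1 v) //= big1 ?finset.setU0 // => u /andP[Eu].
by rewrite (first_in_largest_inj Eu Ev) eqxx.
Qed.

Lemma ex_first_in_largest E : 0 < n -> exists v, first_in_largest E v.
Proof.
move=> n0; pose v0 := Ordinal n0.
have [v1 _ v1P] := @arg_maxnP _ v0 xpredT (fun v => #|component E v|) isT.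
have [v vP vmin] := @arg_minnP _ v1
  (fun v => #|component E v1| <= #|component E v|) val (leqnn _).
exists v; apply/andP; split; apply/forallP => u.
  exact: leq_trans (v1P u isT) vP.
apply/implyP => uv; apply: leq_trans vP; rewrite ltnNge.
by apply: contraTN uv => /vmin; rewrite -leqNgt.
Qed.

Lemma leq_component_L1 E v : #|component E v| <= #|L1 E|.
Proof.
have [w Ew] := ex_first_in_largest E (leq_ltn_trans (leq0n _) (ltn_ord v)).
by rewrite (L1_component Ew); case/andP: Ew => /forallP.
Qed.

Lemma adj_sym E : connect_sym (adj E).
Proof. by apply: sym_connect_sym => u v; rewrite /adj finset.setUC. Qed.

Lemma sqr_L1_leq E : #|L1 E| ^ 2 <= \sum_v #|component E v|.
Proof.
have [n0|n0] := posnP n.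
  rewrite (_ : L1 E = finset.set0) ?cards0 //.
  by apply/setP => v; have := ltn_ord v; rewrite {2}n0.
have [w Ew] := ex_first_in_largest E n0.
rewrite (L1_component Ew) -mulnn -sum_nat_const big_mkcond /=.
apply: leq_sum => v _; case: ifP => //; rewrite inE => wv.
apply/eq_leq/eq_card => u; rewrite !inE.
by rewrite (same_connect (adj_sym E) wv).
Qed.

End LargestComponent.

(** * Revealing edges and coins in both percolation models *)

Section Exploration.
Set Implicit Arguments.
Unset Strict Implicit.
Local Open Scope set_scope.
Local Open Scope bool_scope.

Variables (R : realType) (n : nat).
Implicit Types (G H E S : graph n) (U : {set 'I_n}) (u v w : 'I_n).

(* Common to both percolations: the percolated graph is a function of the graph
   and of a random set of heads, and crossing the edge from [u] to a fresh
   vertex [w] costs the single coin [coin u w], which tells whether [w] gets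
   into the percolated component of [u]. *)
Record coin_model (F : graph n -> graph n -> graph n)
    (coin : 'I_n -> 'I_n -> {set 'I_n}) (alive : graph n -> pred 'I_n) : Prop :=
  CoinModel {
    model_sub : forall G S, F G S \subset G;
    model_coin : forall G S u w, adj (F G S) u w -> coin u w \in S;
    model_mem : forall u w, w \in coin u w;
    model_coin_sub : forall u w, coin u w \subset [set u; w];
    model_root : forall S w, [set w] \in S -> alive S w;
    model_step : forall G S u w, alive S u -> adj G u w -> coin u w \in S ->
      adj (F G S) u w /\ alive S w }.

(** Every vertex is alive. The coin [[set w]] flipped at a new root is a dummy, not consulted by a
    simple graph; it lets both models obey the same recursion. *)
Lemma bond_model : coin_model (@bond_graph n) (fun u w => [set u; w]) (fun _ => predT).
Proof.
split=> //.
- by move=> G S; apply: finset.subsetIl.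
- by move=> G S u w; rewrite /adj inE => /andP[].
- by move=> u w; rewrite set22.
- by move=> G S u w _ uw uwS; split=> //; rewrite /adj inE uwS andbT.
Qed.

(** Alive means retained. Since the near end of the edge is already known to be retained, only the
    coin of the far end is needed. *)
Lemma site_model : coin_model (@site_graph n) (fun _ w => [set w])
  (fun S u => [set u] \in S).
Proof.
split=> //.
- by move=> G S; apply/fintype.subsetP => e; rewrite inE => /andP[].
- by move=> G S u w; rewrite /adj inE => /andP[_ /forall_inP]; apply; rewrite set22.
- by move=> u w; rewrite set11.
- by move=> u w; rewrite finset.sub1set set22.
- move=> G S u w uS uw wS; split=> //; rewrite /adj inE; apply/andP; split=> //.
  by apply/forall_inP => x; rewrite !inE => /orP[]/eqP->.
Qed.

Lemma sum_deg H : simple H -> (\sum_v deg H v = 2 * #|H|)%N.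
Proof.
move=> /forall_inP Hs; under eq_bigr do rewrite degE.
rewrite exchange_big /= mulnC -sum_nat_const; apply: eq_bigr => e /Hs/eqP e2.
by transitivity #|e|; [rewrite -sum1_card [RHS]big_mkcond|rewrite e2].
Qed.

Variable d : n.-tuple nat.
Local Notation completions := (completions d).
Local Notation residual := (residual d).

Lemma sum_residual H G : G \in completions H ->
  (\sum_v residual H v + 2 * #|H| = \sum_v tnth d v)%N.
Proof.
case/completionsP => Gs Gd HG; rewrite -sum_deg ?(simpleS HG) // -big_split /=.
by apply: eq_bigr => v _; rewrite /residual subnK // -Gd degS.
Qed.

(** Each completion of [H] has exactly [residual H u] edges at [u] outside [H], so it is counted
    that many times on the left. This reveals a uniformly chosen edge at [u] without recording the
    absence of any other. *)
Lemma sum_reveal H u (c : graph n -> R) :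
  \sum_(w | [set u; w] \notin H) \sum_(G in completions ([set u; w] |: H)) c G
  = (residual H u)%:R * \sum_(G in completions H) c G.
Proof.
under eq_bigr => w _ do under eq_bigl => G do rewrite completionsU1.
rewrite (exchange_big_dep (mem (completions H))) /=; last first.
  by move=> w G _ /andP[].
rewrite mulr_sumr; apply: eq_bigr => G GC.
rewrite -(sum_adjD u GC) natr_sum mulr_suml big_mkcond /=; apply: eq_bigr => w _.
rewrite GC /adj inE; case: (_ \in H) => /=; first by rewrite mul0r.
by case: (_ \in G); rewrite ?mul1r ?mul0r.
Qed.

Lemma deg_fresh H U w : (forall e, e \in H -> e \subset U) -> w \notin U -> deg H w = 0%N.
Proof.
move=> HU wU; apply/eqP; rewrite cards_eq0; apply/eqP/setP => e; rewrite !inE.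
by apply/andP => -[/HU/fintype.subsetP/[apply]]; apply/negP.
Qed.

Lemma pair_fresh H U u w : (forall e, e \in H -> e \subset U) -> w \notin U ->
  [set u; w] \notin H.
Proof.
by move=> HU; apply: contra => /HU/fintype.subsetP; apply; rewrite set22.
Qed.

Lemma deg_setU1 H u w v : [set u; w] \notin H -> u != w ->
  deg ([set u; w] |: H) v = ((v == u) + (v == w) + deg H v)%N.
Proof. by move=> uwH uw; rewrite !degE big_setU1 //= (in_set2_addn v uw). Qed.

End Exploration.

(** * Self-avoiding paths *)

Section PathCounting.
Set Implicit Arguments.
Unset Strict Implicit.
Local Open Scope set_scope.
Local Open Scope bool_scope.

Variable n : nat.
Implicit Types (G H E S : graph n) (U A : {set 'I_n}) (u v w : 'I_n).

(** Enlarging [U] along the way makes the paths self-avoiding, so that every step uses a fresh edge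
    and a fresh coin. *)
Fixpoint npaths E U v (j : nat) : nat :=
  if j is j'.+1 then \sum_(w | (w \notin U) && adj E v w) npaths E (w |: U) w j' else 1%N.

(** A vertex reached by a path of fewer than [k] edges is counted by that path. Any other one is
    reached through the first [k] edges of its path, and each such beginning leads to at most [n]
    vertices. *)
Lemma card_leq_npaths E k U v A :
  (forall w, w \in A -> exists s, [/\ path (adj E) v s, uniq s,
     all (fun x => x \notin U) s & last v s = w]) ->
  (#|A| <= \sum_(j < k) npaths E U v j + n * npaths E U v k)%N.
Proof.
elim: k U v A => [|k IH] U v A HA.
  by rewrite big_ord0 muln1 add0n -[leqRHS](card_ord n) max_card.
pose B w := [set x in A | `[< exists s, [/\ path (adj E) w s, uniq s,
     all (fun x => x \notin w |: U) s & last w s = x] >]].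
have AB : (#|A| <= 1 + \sum_(w | (w \notin U) && adj E v w) #|B w|)%N.
  have -> : (1 = \sum_x (x == v))%N.
    by rewrite (bigD1 v) //= eqxx big1 // => x /negbTE ->.
  have -> : (\sum_(w | (w \notin U) && adj E v w) #|B w|
      = \sum_x \sum_(w | (w \notin U) && adj E v w) (x \in B w))%N.
    rewrite exchange_big; apply: eq_bigr => w _.
    by rewrite -sum1_card big_mkcond.
  rewrite -big_split -sum1_card big_mkcond /=; apply: leq_sum => x _.
  case: ifP => // xA; have [[|w s] [/= ps us sU lx]] := HA x xA.
    by rewrite lx eqxx.
  case/andP: ps => vw ps; case/andP: us => ws us; case/andP: sU => wU sU.
  rewrite (bigD1 w) /=; last by rewrite wU.
  suff -> : x \in B w by rewrite addnCA.
  rewrite inE xA; apply/asboolP; exists s; split=> //.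
  apply/allP => y ys; rewrite !inE negb_or (allP sU) // andbT.
  by apply: contraNneq ws => <-.
apply: leq_trans AB _; rewrite big_ord_recl /= -addnA leq_add2l.
under [X in (_ <= X + _)%N]eq_bigr do rewrite /= .
rewrite exchange_big /= big_distrr -big_split /=; apply: leq_sum => w _.
by apply: IH => x; rewrite inE => /andP[_ /asboolP].
Qed.

Lemma card_component_npaths E k v :
  (#|component E v| <= \sum_(j < k) npaths E [set v] v j + n * npaths E [set v] v k)%N.
Proof.
apply: card_leq_npaths => w; rewrite inE => /connectP[s ps ->].
case/shortenP: ps => s' ps' us' _; exists s'; case/andP: us' => vs' us'.
split=> //; apply/allP => x xs; rewrite inE.
by apply: contraNneq vs' => <-.
Qed.

End PathCounting.

(** * Counting paths below the threshold *)

Section Subcritical.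
Set Implicit Arguments.
Unset Strict Implicit.
Local Open Scope set_scope.
Local Open Scope bool_scope.

Variables (R : realType) (n : nat) (d : n.-tuple nat).
Implicit Types (G H E S : graph n) (U : {set 'I_n}) (u v w : 'I_n).
Local Notation completions := (completions d).
Local Notation residual := (residual d).

Variables (p : R) (F : graph n -> graph n -> graph n)
  (coin : 'I_n -> 'I_n -> {set 'I_n}) (alive : graph n -> pred 'I_n).
Hypothesis p01 : 0 <= p <= 1.
Hypothesis FM : coin_model F coin alive.

Local Lemma p_ge0 : 0 <= p. Proof. by case/andP: p01. Qed.

(** An unnormalised expectation of the number of continuations of a path whose edges [H] and heads
    [Z] are already used. Only heads are prescribed, so a step contributes one factor [p]. *)
Definition path_mass H (Z : graph n) U v j : R :=
  \sum_(G in completions H) \sum_(S : graph n | Z \subset S)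
    coin_weight p S * (npaths (F G S) U v j)%:R.

Lemma path_mass0 H Z U v : path_mass H Z U v 0 = #|completions H|%:R * p ^+ #|Z|.
Proof.
rewrite /path_mass -sum_coin_weight_superset mulr_natl -sumr_const.
apply: eq_bigr => G _.
by apply: eq_bigr => S _; rewrite mulr1.
Qed.

(** A percolated edge [vw] is an edge of the graph and its coin shows heads; keeping only these two
    consequences gives an upper bound. *)
Lemma path_massS H Z U v j :
  path_mass H Z U v j.+1 <=
  \sum_(w | w \notin U)
     path_mass ([set v; w] |: H) (coin v w |: Z) (w |: U) w j.
Proof.
rewrite /path_mass exchange_big /=.
under [leRHS]eq_bigr => w _ do rewrite exchange_big /=.
have -> : \sum_(S : graph n | Z \subset S) \sum_(G in completions H)
    coin_weight p S * (npaths (F G S) U v j.+1)%:R =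
  \sum_(w | w \notin U) \sum_(S : graph n | Z \subset S) \sum_(G in completions H)
    coin_weight p S * ((adj (F G S) v w)%:R * (npaths (F G S) (w |: U) w j)%:R).
  rewrite [RHS]exchange_big /=; apply: eq_bigr => S _.
  rewrite [RHS]exchange_big /=; apply: eq_bigr => G _.
  rewrite -mulr_sumr natr_sum big_mkcondr /=; congr (_ * _).
  by apply: eq_bigr => w _; case: adj; rewrite ?mul1r ?mul0r.
apply: ler_sum => w _; rewrite big_mkcond [leRHS]big_mkcond /=.
apply: ler_sum => S _; rewrite finset.subUset finset.sub1set.
case: (boolP (Z \subset S)) => ZS; rewrite ?andbT ?andbF //.
rewrite big_mkcond /= [X in _ <= (if _ then X else _)]big_mkcond /=.
case: ifPn => cS; last first.
  rewrite big1 // => G _; case: ifP => // _.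
  by case: (boolP (adj _ v w)) => [/(model_coin FM)|]; rewrite ?(negbTE cS) ?mul0r ?mulr0.
apply: ler_sum => G _; rewrite completionsU1; case: (_ \in completions H) => //=.
case: (boolP (adj (F G S) v w)) => [vw|_].
  by rewrite (fintype.subsetP (model_sub FM G S) _ vw) mul1r.
by rewrite mul0r mulr0; case: ifP => // _; rewrite mulr_ge0 ?ler0n ?coin_weight_ge0.
Qed.

Variables (Delta k : nat) (rho : R).
Hypothesis dD : forall v, (tnth d v <= Delta)%N.
(** A lower bound, valid after at most [k] revealed edges, for the number of unrevealed half-edges
    minus the invalid choices in the switching. Thus [rho] bounds the mean number of further edges
    at the far end of a revealed edge. *)
Let m0 : R := (\sum_v tnth d v)%:R - (2 * k)%:R - (2 * (Delta.+1 * Delta))%:R.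
Hypothesis m0_gt0 : 0 < m0.
Hypothesis rho_bound : (\sum_v tnth d v * (tnth d v).-1)%:R <= rho * m0.

Lemma card_completions_upper H u w : (#|H| <= k)%N -> u != w -> [set u; w] \notin H ->
  #|completions ([set u; w] |: H)|%:R * m0
  <= #|completions H|%:R * (residual H u * residual H w)%:R :> R.
Proof.
move=> Hk uw uwH.
have [->|/card_gt0P[G]] := posnP #|completions ([set u; w] |: H)|.
  by rewrite mul0r mulr_ge0 ?ler0n.
rewrite completionsU1 => /andP[GC _].
have := switch_upper uw uwH dD; have := sum_residual GC.
set N1 := #|_| => E1.
rewrite -(ler_nat R) !natrM natrD !natrM -lerBlDr -mulrBr; apply: le_trans.
rewrite ler_wpM2l ?ler0n // /m0 -E1 natrD -!natrM lerD2r lerBlDr lerD2l ler_nat.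
by rewrite leq_mul2l Hk orbT.
Qed.

Lemma rho_ge0 : 0 <= rho.
Proof. by rewrite -(pmulr_lge0 _ m0_gt0); apply: le_trans rho_bound; rewrite ler0n. Qed.

Lemma sum_completions_le H U v : v \in U ->
  (forall e, e \in H -> e \subset U) ->
  \sum_(w | w \notin U) #|completions ([set v; w] |: H)|%:R
  <= #|completions H|%:R * (residual H v)%:R :> R.
Proof.
move=> vU HU; rewrite mulrC -[#|_|%:R]sumr_const -sum_reveal.
rewrite big_mkcond [leRHS]big_mkcond /=; apply: ler_sum => w _.
case: ifPn => wU; last by case: ifP => // _; rewrite sumr_ge0.
by rewrite (pair_fresh v HU wU) sumr_const.
Qed.

(** The switching bounds the share of graphs with the edge [vw] by [residual H v] times
    [tnth d w / m0], and [(tnth d w).-1] edges remain at [w]; summing over [w] gives one factor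
    [rho]. The last edge is summed exactly by [sum_completions_le], so [j.+1] edges cost only
    [rho ^+ j]. *)
Lemma path_mass_bound j H (Z : graph n) U v : v \in U ->
  (forall e, e \in H -> e \subset U) -> (forall c, c \in Z -> c \subset U) ->
  (#|H| + j <= k)%N ->
  path_mass H Z U v j.+1 <=
  #|completions H|%:R * (residual H v)%:R * p ^+ (#|Z| + j.+1) * rho ^+ j.
Proof.
elim: j H Z U v => [|j IH] H Z U v vU HU ZU Hk; apply: le_trans (path_massS _ _ _ _ _) _.
  have cZ w : w \notin U -> #|coin v w |: Z| = #|Z|.+1.
    move=> wU; rewrite cardsU1 (contra _ wU) // => /ZU/fintype.subsetP; apply.
    exact: (model_mem FM).
  rewrite expr0 mulr1 addn1.
  apply: le_trans (ler_wpM2r _ (sum_completions_le vU HU)); last exact/exprn_ge0/p_ge0.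
  rewrite mulr_suml; apply: ler_sum => w wU.
  by rewrite path_mass0 cZ.
have cZ w : w \notin U -> #|coin v w |: Z| = #|Z|.+1.
  move=> wU; rewrite cardsU1 (contra _ wU) // => /ZU/fintype.subsetP; apply.
  exact: (model_mem FM).
have pU w : [set v; w] \subset w |: U.
  by apply/fintype.subsetP => x; rewrite !inE => /orP[]/eqP->; rewrite ?vU ?eqxx ?orbT.
have step w : w \notin U ->
    path_mass ([set v; w] |: H) (coin v w |: Z) (w |: U) w j.+1 <=
    #|completions H|%:R * (residual H v)%:R * p ^+ (#|Z| + j.+2) * rho ^+ j
    * ((tnth d w * (tnth d w).-1)%:R / m0).
  move=> wU; have vw : v != w by apply: contraNneq wU => <-.
  apply: le_trans (IH _ _ _ _ _ _ _ _) _.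
  - by rewrite !inE eqxx.
  - move=> e; rewrite !inE => /orP[/eqP ->|/HU eU] //.
    exact: fintype.subset_trans eU (finset.subsetUr _ _).
  - move=> e; rewrite !inE => /orP[/eqP ->|/ZU eU].
      exact: fintype.subset_trans (model_coin_sub FM _ _) (pU w).
    exact: fintype.subset_trans eU (finset.subsetUr _ _).
  - by rewrite cardsU1 (pair_fresh v HU wU) /= add1n addSnnS.
  rewrite cZ // addSnnS [leRHS]mulrAC.
  rewrite ler_wpM2r ?exprn_ge0 ?rho_ge0 // [leRHS]mulrAC.
  rewrite ler_wpM2r ?exprn_ge0 ?p_ge0 //.
  have -> : residual ([set v; w] |: H) w = (tnth d w).-1.
    rewrite /residual deg_setU1 ?(pair_fresh v HU wU) // (deg_fresh HU wU).
    by rewrite eqxx (eq_sym w) (negbTE vw) subn1.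
  have rw : residual H w = tnth d w by rewrite /residual (deg_fresh HU wU) subn0.
  have Hk' : (#|H| <= k)%N by apply: leq_trans Hk; rewrite leq_addr.
  have := card_completions_upper Hk' vw (pair_fresh v HU wU).
  rewrite rw => /(ler_wpM2r (ler0n R (tnth d w).-1)) le_w.
  by rewrite [leRHS]mulrA ler_pdivlMr //; move: le_w; rewrite !natrM; lra.
apply: le_trans (ler_sum _ step) _; rewrite -mulr_sumr exprSr mulrA.
have c0 : 0 <= #|completions H|%:R * (residual H v)%:R * p ^+ (#|Z| + j.+2) * rho ^+ j.
  by rewrite !mulr_ge0 ?ler0n ?exprn_ge0 ?p_ge0 ?rho_ge0.
rewrite ler_wpM2l // -mulr_suml ler_pdivrMr //; apply: le_trans rho_bound.
rewrite natr_sum big_mkcond /=; apply: ler_sum => w _.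
by case: ifP => // _; rewrite ler0n.
Qed.

Hypothesis prho : p * rho <= 1.

Lemma path_mass_start j v : (j <= k)%N ->
  path_mass finset.set0 finset.set0 [set v] v j.+1
  <= #|graphs_of d|%:R * (tnth d v)%:R * (p * rho) ^+ j.
Proof.
move=> jk; apply: le_trans (path_mass_bound _ _ _ _) _; rewrite ?set11 //.
- by move=> e; rewrite inE.
- by move=> e; rewrite inE.
- by rewrite cards0.
have -> : completions finset.set0 = graphs_of d.
  by apply/setP => G; rewrite finset.in_set finset.sub0set andbT.
have -> : residual finset.set0 v = tnth d v.
  rewrite /residual (deg_fresh (U := finset.set0)) ?subn0 ?inE // => e.
  by rewrite inE.
rewrite cards0 add0n exprS exprMn [leRHS]mulrA ler_wpM2r ?exprn_ge0 ?rho_ge0 //.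
rewrite ler_wpM2l ?mulr_ge0 ?ler0n // ler_piMl ?exprn_ge0 ?p_ge0 //.
by case/andP: p01.
Qed.

(** Markov's inequality for the squared order of the largest component. Paths without edges
    contribute [n], each length from 1 to [k] at most the degree sum, and the paths of [k.+1] edges
    carry the factor [n] of the cut-off. *)
Lemma subcritical_bound (perc : percolation R) (x : R) : 0 <= x ->
  (forall G X, perc n G X = \sum_(S | F G S == X) coin_weight p S) ->
  (0 < #|graphs_of d|)%N ->
  prob perc d [pred E | x < #|L1 E|%:R] * x ^+ 2 <=
  n%:R + (\sum_v tnth d v)%:R * (k%:R + n%:R * (p * rho) ^+ k).
Proof.
move=> x0 percE N0; rewrite (prob_coins _ _ percE).
have N0R : 0 < #|graphs_of d|%:R :> R by rewrite ltr0n.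
rewrite -mulrA ler_pdivrMl // mulr_suml.
have E0 : completions finset.set0 = graphs_of d.
  by apply/setP => G; rewrite finset.in_set finset.sub0set andbT.
apply: (@le_trans _ _ (\sum_v (\sum_(j < k.+1) path_mass finset.set0 finset.set0 [set v] v j
    + n%:R * path_mass finset.set0 finset.set0 [set v] v k.+1))).
  rewrite /path_mass E0.
  have -> : \sum_v (\sum_(j < k.+1) \sum_(G in graphs_of d)
        \sum_(S : graph n | finset.set0 \subset S)
           coin_weight p S * (npaths (F G S) [set v] v j)%:R +
      n%:R * \sum_(G in graphs_of d) \sum_(S : graph n | finset.set0 \subset S)
         coin_weight p S * (npaths (F G S) [set v] v k.+1)%:R)
    = \sum_(G in graphs_of d) \sum_S coin_weight p S *
       (\sum_v (\sum_(j < k.+1) npaths (F G S) [set v] v j +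
         n * npaths (F G S) [set v] v k.+1))%:R.
    rewrite big_split /= -mulr_sumr.
    under eq_bigr do rewrite exchange_big /=.
    rewrite exchange_big /= [X in _ + _ * X]exchange_big /= mulr_sumr -big_split /=.
    apply: eq_bigr => G _.
    under eq_bigr do rewrite exchange_big /=.
    rewrite exchange_big /= [X in _ + _ * X]exchange_big /= mulr_sumr -big_split /=.
    apply: eq_big => S; rewrite ?finset.sub0set // => _.
    rewrite natr_sum mulr_sumr.
    under eq_bigr do rewrite -mulr_sumr.
    rewrite -!mulr_sumr mulrCA -mulrDr mulr_sumr -mulr_sumr; congr (_ * _).
    rewrite mulr_sumr -big_split /=; apply: eq_bigr => v _.
    by rewrite -natr_sum natrD natrM.
  apply: ler_sum => G _; rewrite mulr_suml; apply: ler_sum => S _.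
  rewrite mulrAC mulrC ler_wpM2l ?coin_weight_ge0 //.
  apply: (@le_trans _ _ ((#|L1 (F G S)| ^ 2)%:R)).
    rewrite natrX /=; case: ltP => xL; last by rewrite mul0r exprn_ge0.
    by rewrite mul1r lerXn2r ?nnegrE ?ler0n // ltW.
  rewrite ler_nat; apply: leq_trans (sqr_L1_leq _) _.
  by apply: leq_sum => v _; apply: card_component_npaths.
set N := #|graphs_of d|%:R.
have -> : N * (n%:R + (\sum_v tnth d v)%:R * (k%:R + n%:R * (p * rho) ^+ k))
    = \sum_(v < n) (N + (N * (tnth d v)%:R * k%:R + n%:R * (N * (tnth d v)%:R * (p * rho) ^+ k))).
  rewrite !big_split /= sumr_const card_ord -mulr_natr -mulr_sumr -!mulr_suml -!mulr_sumr.
  by rewrite natr_sum; ring.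
apply: ler_sum => v _; rewrite big_ord_recl path_mass0 E0 cards0 expr0 mulr1 -addrA lerD2l.
rewrite lerD //.
  rewrite mulr_natr -[X in _ *+ X](card_ord k) -sumr_const; apply: ler_sum => j _.
  apply: le_trans (path_mass_start _ (ltnW (ltn_ord j))) _.
  by rewrite ler_piMr ?mulr_ge0 ?ler0n // exprn_ile1 ?mulr_ge0 ?p_ge0 ?rho_ge0.
by rewrite ler_wpM2l ?ler0n // path_mass_start.
Qed.

End Subcritical.

(** * Exploration of a component above the threshold *)

Section Supercritical.
Set Implicit Arguments.
Unset Strict Implicit.
Local Open Scope set_scope.
Local Open Scope bool_scope.

Variables (R : realType) (n : nat) (d : n.-tuple nat).
Implicit Types (G H E S O X : graph n) (K U W : {set 'I_n}) (u v w : 'I_n).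
Local Notation completions := (completions d).
Local Notation residual := (residual d).

Variables (p : R) (F : graph n -> graph n -> graph n)
  (coin : 'I_n -> 'I_n -> {set 'I_n}) (alive : graph n -> pred 'I_n).
Hypothesis p01 : 0 <= p <= 1.
Hypothesis FM : coin_model F coin alive.

Lemma flip_tails O X c S : X \subset O -> c \notin O ->
  (S :&: (c |: O) == X) = (S :&: O == X) && (c \notin S).
Proof.
move=> /fintype.subsetP SO cO; apply/eqP/andP => [E|[/eqP <- cS]].
  have cS : c \notin S.
    apply/negP => cS; have : c \in X by rewrite -E !inE cS eqxx.
    by move/SO; apply/negP.
  split=> //; apply/eqP; rewrite -E; apply/setP => x; rewrite !inE.
  by case: eqVneq => // ->; rewrite (negbTE cS).
by apply/setP => x; rewrite !inE; case: eqVneq => // ->; rewrite (negbTE cS).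
Qed.

Lemma flip_heads O X c S : X \subset O -> c \notin O ->
  (S :&: (c |: O) == c |: X) = (S :&: O == X) && (c \in S).
Proof.
move=> /fintype.subsetP SO cO; apply/eqP/andP => [E|[/eqP <- cS]].
  have cS : c \in S.
    by have /setIP[] : c \in S :&: (c |: O) by rewrite E setU11.
  split=> //; apply/eqP/setP => x; move/setP/(_ x): E; rewrite !inE.
  case: eqVneq => // -> _; rewrite (negbTE cO) andbF.
  by apply/esym/negbTE; apply: contra cO => /SO.
by apply/setP => x; rewrite !inE; case: eqVneq => // ->; rewrite cS.
Qed.

(* After some steps of the exploration: [H] are the revealed edges, [W] the
   visited vertices, [X] the heads among the revealed coins [O], and [K] the
   visited part of the percolated component under exploration. *)
Definition explored H W O X K : Prop :=
  [/\ K \subset W, forall e, e \in H -> e \subset W,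
      forall c, c \in O -> c \subset W, X \subset O &
      forall G S, G \in completions H -> S :&: O = X ->
        (forall u, u \in K -> alive S u) /\
        {in K &, forall u v, connect (adj (F G S)) u v}].

Variable A : pred (graph n).

(** The unnormalised weight of the event [A] together with a history. Unlike edges, the coins of [O]
    are prescribed with both outcomes. *)
Definition mass H O X : R :=
  \sum_(G in completions H) \sum_(S | S :&: O == X) (A (F G S))%:R * coin_weight p S.

Definition cylinder O X : R := \prod_(c in O) (if c \in X then p else 1 - p).

(** The number Y of the overview. An unrevealed edge inside [K] counts twice, so revealing it lowers
    the value by 2, the worst loss in one step. *)
Definition boundary H K : nat := \sum_(u in K) residual H u.

Local Lemma q_ge0 : 0 <= 1 - p. Proof. by rewrite subr_ge0; case/andP: p01. Qed.
Local Lemma p_nonneg : 0 <= p. Proof. by case/andP: p01. Qed.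

Lemma cylinder_ge0 O X : 0 <= cylinder O X.
Proof. by apply: prodr_ge0 => c _; case: ifP; rewrite ?q_ge0 ?p_nonneg. Qed.

Lemma cylinder_tails O X c : X \subset O -> c \notin O ->
  cylinder (c |: O) X = (1 - p) * cylinder O X.
Proof.
move=> SO cO; rewrite /cylinder big_setU1 //=; case: ifP => // /(fintype.subsetP SO).
by rewrite (negbTE cO).
Qed.

Lemma cylinder_heads O X c : X \subset O -> c \notin O ->
  cylinder (c |: O) (c |: X) = p * cylinder O X.
Proof.
move=> SO cO; rewrite /cylinder big_setU1 //= !inE eqxx /=; congr (_ * _).
apply: eq_bigr => x xO; rewrite !inE; case: eqVneq => // xc.
by rewrite -xc xO in cO.
Qed.

Lemma mass_flip H O X c : X \subset O -> c \notin O ->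
  mass H O X = mass H (c |: O) X + mass H (c |: O) (c |: X).
Proof.
move=> SO cO; rewrite /mass -big_split /=; apply: eq_bigr => G _.
rewrite (bigID (fun S => c \notin S)) /=; congr (_ + _); apply: eq_bigl => S.
  by rewrite flip_tails.
by rewrite flip_heads ?negbK.
Qed.

Lemma mass_reveal H O X u :
  (residual H u)%:R * mass H O X =
  \sum_(w | [set u; w] \notin H) mass ([set u; w] |: H) O X.
Proof. by rewrite /mass sum_reveal. Qed.

Lemma mass_le H O X : X \subset O ->
  mass H O X <= #|completions H|%:R * cylinder O X.
Proof.
move=> SO; rewrite mulr_natl -sumr_const; apply: ler_sum => G _.
rewrite /cylinder -sum_coin_weight_cylinder //; apply: ler_sum => S _.
by rewrite ler_piMl ?coin_weight_ge0 // lern1; case: (A _).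
Qed.

Lemma explored_reveal H W O X K u w : u \in W -> w \in W ->
  explored H W O X K -> explored ([set u; w] |: H) W O X K.
Proof.
move=> uW wW [KW HW OW SO KA]; split=> //.
  move=> e; rewrite !inE => /orP[/eqP ->|/HW //].
  by rewrite finset.subUset !finset.sub1set uW.
by move=> G S; rewrite completionsU1 => /andP[GC _]; apply: KA.
Qed.

Lemma explored_visit H W O X K w :
  explored H W O X K -> explored H (w |: W) O X K.
Proof.
move=> [KW HW OW SO KA]; split=> //.
- exact: fintype.subset_trans KW (finset.subsetUr _ _).
- by move=> e /HW eW; apply: fintype.subset_trans eW (finset.subsetUr _ _).
- by move=> e /OW eW; apply: fintype.subset_trans eW (finset.subsetUr _ _).
Qed.

Lemma explored_tails H W O X K (c : {set 'I_n}) : c \subset W -> c \notin O ->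
  explored H W O X K -> explored H W (c |: O) X K.
Proof.
move=> cW cO [KW HW OW SO KA]; split=> //.
- by move=> e; rewrite !inE => /orP[/eqP ->|/OW].
- exact: fintype.subset_trans SO (finset.subsetUr _ _).
move=> G S GC /eqP; rewrite flip_tails // => /andP[/eqP ES _].
exact: KA.
Qed.

Lemma explored_heads H W O X K u w : u \in K -> w \in W ->
  coin u w \subset W -> coin u w \notin O -> [set u; w] \in H ->
  explored H W O X K -> explored H W (coin u w |: O) (coin u w |: X) (w |: K).
Proof.
move=> uK wW cW cO uwH [KW HW OW SO KA]; split=> //.
- by rewrite finset.subUset finset.sub1set wW.
- by move=> e; rewrite !inE => /orP[/eqP ->|/OW].
- exact: finset.setUS.
move=> G S GC /eqP; rewrite flip_heads // => /andP[/eqP ES cS].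
have [KA1 KA2] := KA G S GC ES.
have [_ _ /fintype.subsetP HG] := completionsP _ _ _ GC.
have [uw Aw] := model_step FM (KA1 u uK) (HG _ uwH) cS.
split=> [x|x y].
  by rewrite !inE => /orP[/eqP->|/KA1].
have uy z : z \in w |: K -> connect (adj (F G S)) u z.
  by rewrite finset.in_setU1 => /orP[/eqP->|zK]; [apply: connect1|apply: KA2].
by move=> /uy ux /uy uz; apply: connect_trans uz; rewrite adj_sym.
Qed.

Lemma explored_root H W O X K w : w \notin W -> [set w] \notin O ->
  explored H W O X K ->
  explored H (w |: W) ([set w] |: O) ([set w] |: X) [set w].
Proof.
move=> wW cO [KW HW OW SO KA]; split=> //.
- by rewrite finset.subsetUl.
- by move=> e /HW eW; apply: fintype.subset_trans eW (finset.subsetUr _ _).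
- move=> e; rewrite finset.in_setU1 => /orP[/eqP ->|/OW eW].
    exact: finset.subsetUl.
  exact: fintype.subset_trans eW (finset.subsetUr _ _).
- exact: finset.setUS.
move=> G S GC /eqP; rewrite flip_heads // => /andP[_ cS].
by split=> [x|x y]; rewrite !inE => /eqP ->; [apply: (model_root FM)|move=> /eqP ->].
Qed.

Lemma residual_setU1 H u w v : [set u; w] \notin H -> u != w ->
  (residual H v <= residual ([set u; w] |: H) v + ((v == u) + (v == w)))%N.
Proof. by move=> uwH uw; rewrite /residual deg_setU1 //; lia. Qed.

Lemma boundary_setU1 H K u w : [set u; w] \notin H -> u != w ->
  (boundary H K <= boundary ([set u; w] |: H) K + ((u \in K) + (w \in K)))%N.
Proof.
move=> uwH uw.
have inK x : ((x \in K) = \sum_(v in K) (v == x) :> nat)%N.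
  rewrite -big_mkcondr /= (eq_bigl (fun v => (v == x) && (x \in K))).
    by rewrite big_mkcondr /= big_pred1_eq.
  by move=> v; case: eqVneq => [->|]; rewrite ?andbT ?andbF.
rewrite !inK -!big_split /=; apply: leq_sum => v _.
exact: residual_setU1.
Qed.

Variables (T Y0 : nat) (theta beta lambda : R).
Hypothesis theta0 : 0 <= theta.
Hypothesis lambda01 : 0 <= lambda <= 1.
Hypothesis Y0_gt0 : (0 < Y0)%N.
Hypothesis small_component : forall E v, A E ->
  (\sum_(u in component E v) tnth d u < Y0)%N.
Hypothesis edge_lower : forall H u w, (#|H| <= T)%N -> u != w -> [set u; w] \notin H ->
  #|completions H|%:R * (residual H u)%:R * ((residual H w)%:R * beta)
  <= #|completions ([set u; w] |: H)|%:R.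
Hypothesis root_exists : forall W, (#|W| <= T)%N ->
  exists2 w, w \notin W & (0 < tnth d w)%N.
Hypothesis root_drift : (1 - p) + p * expR (- theta) <= lambda.

(** The mean factor on the potential when the revealed edge leads to a fresh [w]: tails lose one
    unrevealed edge, heads lose one and gain [tnth d w - 1]. *)
Let gain w : R := (1 - p) * expR theta + p * expR (theta * (2 - (tnth d w)%:R)).

Hypothesis edge_drift : forall W, (#|W| <= T)%N ->
  expR (theta * 2) - \sum_(w | w \notin W) (tnth d w)%:R * beta * (expR (theta * 2) - gain w)
  <= lambda.

(** Normalised to be at least 1 as long as the boundary is at most [Y0]. *)
Definition potential (y : nat) : R := expR (theta * (Y0%:R - y%:R)).

Lemma potential_ge0 y : 0 <= potential y. Proof. exact: expR_ge0. Qed.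

Lemma potential_le y z (r : R) : y%:R <= z%:R + r ->
  potential z <= potential y * expR (theta * r).
Proof.
by move=> yz; rewrite -expRD ler_expR -mulrDr ler_wpM2l //; move: yz; lra.
Qed.

(** [K] lies in one percolated component, whose total degree is at least the boundary; once this
    reaches [Y0], the event [A] is impossible. *)
Lemma mass_eq0 H W O X K : explored H W O X K ->
  (Y0 <= boundary H K)%N -> mass H O X = 0.
Proof.
move=> [KW HW OW SO KA] YK; rewrite /mass big1 // => G GC; rewrite big1 // => S /eqP ES.
have [_ KC] := KA G S GC ES.
have [u uK] : exists u, u \in K.
  apply/set0Pn; apply: contraTneq YK => ->; rewrite /boundary big_set0.
  by rewrite -ltnNge.
case: (boolP (A _)) => [/(@small_component _ u)|]; last by rewrite mul0r.
rewrite ltnNge; case/negP; apply: leq_trans YK _.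
apply: (@leq_trans (\sum_(v in K) tnth d v)).
  by apply: leq_sum => v _; rewrite leq_subr.
rewrite [leqRHS](big_setID K) /= (_ : component _ _ :&: K = K) ?leq_addr //.
apply/finset.setIidPr/fintype.subsetP => v vK; rewrite inE.
exact: KC.
Qed.

Lemma gain_le w : gain w <= expR (theta * 2).
Proof.
rewrite -[leRHS]mul1r -[in leRHS](subrK p 1) mulrDl; apply: lerD.
  by rewrite ler_wpM2l ?q_ge0 // ler_expR; move: theta0; lra.
rewrite ler_wpM2l ?p_nonneg // ler_expR ler_wpM2l //.
by have := ler0n R (tnth d w); lra.
Qed.

(** Induction on the number [t] of remaining steps. A step either tries a new root, when the
    boundary is 0, or reveals an edge at a vertex of [K]; it enlarges [H] and [W] by at most one
    element each and contracts the potential by [lambda] on average. With no step left, either the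
    boundary has reached [Y0] and the mass vanishes, or the potential is at least 1. *)
Lemma mass_bound t H W O X K : explored H W O X K ->
  (#|H| + t <= T)%N -> (#|W| + t <= T)%N ->
  mass H O X <= #|completions H|%:R * cylinder O X
                 * (potential (boundary H K) * lambda ^+ t).
Proof.
elim: t H W O X K => [|t IH] H W O X K HX HT WT.
  have [YK|YK] := leqP Y0 (boundary H K).
    by rewrite (mass_eq0 HX YK) !mulr_ge0 ?ler0n ?cylinder_ge0 ?potential_ge0 ?exprn_ge0 //;
       case/andP: lambda01.
  have [_ _ _ SO _] := HX.
  apply: le_trans (mass_le _ SO) _; rewrite expr0 mulr1 ler_peMr ?mulr_ge0 ?ler0n ?cylinder_ge0 //.
  rewrite -expR0 ler_expR mulr_ge0 // subr_ge0 ler_nat.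
  exact: ltnW.
have [l0 l1] := andP lambda01.
have [KW HW OW SO KA] := HX.
have [Y1|] := posnP (boundary H K).
  have [w wW dw] : exists2 w, w \notin W & (0 < tnth d w)%N.
    by apply: root_exists; apply: leq_trans WT; rewrite leq_addr.
  have cO : [set w] \notin O.
    by apply: contra wW => /OW/fintype.subsetP; apply; rewrite set11.
  rewrite (mass_flip _ SO cO).
  have WU : (#|w |: W| + t <= T)%N by rewrite cardsU1 wW add1n addSnnS.
  have HU : (#|H| + t <= T)%N by apply: leq_trans HT; rewrite leq_add2l.
  have IH0 := IH _ _ _ _ _ (explored_tails (finset.subsetUl _ _) cO (explored_visit w HX)) HU WU.
  have IH1 := IH _ _ _ _ _ (explored_root wW cO HX) HU WU.
  apply: le_trans (lerD IH0 IH1) _.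
  rewrite cylinder_tails // cylinder_heads // Y1.
  have Yw : boundary H [set w] = tnth d w.
    by rewrite /boundary big_set1 /residual (deg_fresh HW wW) subn0.
  have Pw : potential (boundary H [set w]) <= potential 0 * expR (- theta).
    rewrite -(mulrN1 theta); apply: potential_le; rewrite Yw.
    by rewrite lerBrDl addr0 (ler_nat _ 1).
  apply: (@le_trans _ _ (#|completions H|%:R * cylinder O X * lambda ^+ t * potential 0 *
     ((1 - p) + p * expR (- theta)))).
    have c0 : 0 <= #|completions H|%:R * cylinder O X * lambda ^+ t * p.
      by rewrite !mulr_ge0 ?ler0n ?cylinder_ge0 ?exprn_ge0 ?p_nonneg.
    by have := ler_wpM2l c0 Pw; lra.
  rewrite exprSr.
  have c0 : 0 <= #|completions H|%:R * cylinder O X * lambda ^+ t * potential 0.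
    by rewrite !mulr_ge0 ?ler0n ?cylinder_ge0 ?exprn_ge0 ?potential_ge0.
  by have := ler_wpM2l c0 root_drift; lra.
rewrite lt0n sum_nat_eq0 => /forall_inPn[u uK ru].
have uW := fintype.subsetP KW _ uK.
have HU w : [set u; w] \notin H -> (#|[set u; w] |: H| + t <= T)%N.
  by move=> uwH; rewrite cardsU1 uwH add1n addSnnS.
pose M := cylinder O X * (potential (boundary H K) * lambda ^+ t).
have M0 : 0 <= M by rewrite !mulr_ge0 ?cylinder_ge0 ?potential_ge0 ?exprn_ge0.
have step w : [set u; w] \notin H ->
    mass ([set u; w] |: H) O X <= #|completions ([set u; w] |: H)|%:R * M *
      (if w \in W then expR (theta * 2) else gain w).
  move=> uwH; have [uw|uw] := eqVneq u w.
    rewrite /mass (_ : completions _ = finset.set0); last first.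
      apply/setP => G; rewrite completionsU1 [in RHS]inE.
      apply/negP => /andP[/completionsP[Gs _ _]] /(simple_adj Gs).
      by rewrite uw eqxx.
    by rewrite big_set0 cards0 !mul0r.
  have YU := boundary_setU1 K uwH uw.
  case: ifPn => wW.
    have WU : (#|W| + t <= T)%N by apply: leq_trans WT; rewrite leq_add2l.
    apply: le_trans (IH _ _ _ _ _ (explored_reveal uW wW HX) (HU _ uwH) WU) _.
    have P2 : potential (boundary ([set u; w] |: H) K)
        <= potential (boundary H K) * expR (theta * 2).
      apply: potential_le; rewrite -natrD ler_nat; apply: leq_trans YU _.
      by rewrite leq_add2l; case: (u \in K) (w \in K) => [] [].
    have c2 : 0 <= #|completions ([set u; w] |: H)|%:R * cylinder O X * lambda ^+ t.
      by rewrite !mulr_ge0 ?ler0n ?cylinder_ge0 ?exprn_ge0.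
    by rewrite /M; have := ler_wpM2l c2 P2; lra.
  have wK : w \notin K by apply: contra wW => /(fintype.subsetP KW).
  have cO : coin u w \notin O.
    apply: contra wW => /OW/fintype.subsetP; apply; exact: (model_mem FM).
  have cW : coin u w \subset w |: W.
    apply: fintype.subset_trans (model_coin_sub FM u w) _.
    by rewrite finset.subUset !finset.sub1set !inE uW eqxx orbT.
  have WU : (#|w |: W| + t <= T)%N by rewrite cardsU1 wW add1n addSnnS.
  have HX' : explored ([set u; w] |: H) (w |: W) O X K.
    by apply: explored_reveal (explored_visit w HX); rewrite !inE ?uW ?eqxx ?orbT.
  rewrite (mass_flip _ SO cO).
  have wU : w \in w |: W by rewrite !inE eqxx.
  have uwU : [set u; w] \in [set u; w] |: H by rewrite !inE eqxx.
  have IH0 := IH _ _ _ _ _ (explored_tails cW cO HX') (HU _ uwH) WU.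
  have IH1 := IH _ _ _ _ _ (explored_heads uK wU cW cO uwU HX') (HU _ uwH) WU.
  apply: le_trans (lerD IH0 IH1) _.
  rewrite cylinder_tails // cylinder_heads //.
  rewrite uK (negbTE wK) (_ : (true + false)%N = 1%N) // in YU.
  have P0 : potential (boundary ([set u; w] |: H) K)
      <= potential (boundary H K) * expR theta.
    rewrite -[X in expR X]mulr1; apply: potential_le.
    by rewrite -(natrD _ _ 1) ler_nat.
  have P1 : potential (boundary ([set u; w] |: H) (w |: K))
      <= potential (boundary H K) * expR (theta * (2 - (tnth d w)%:R)).
    apply: potential_le; rewrite {2}/boundary big_setU1 //= -/(boundary _ K).
    have rw : (tnth d w <= residual ([set u; w] |: H) w + 1)%N.
      have := residual_setU1 w uwH uw; rewrite {1}/residual (deg_fresh HW wW) subn0.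
      by rewrite eqxx eq_sym (negbTE uw).
    move: YU rw; rewrite -!(ler_nat R) !natrD; lra.
  rewrite /gain /M.
  have c0 : 0 <= #|completions ([set u; w] |: H)|%:R * cylinder O X * lambda ^+ t * (1 - p).
    by rewrite !mulr_ge0 ?ler0n ?cylinder_ge0 ?exprn_ge0 ?q_ge0.
  have c1 : 0 <= #|completions ([set u; w] |: H)|%:R * cylinder O X * lambda ^+ t * p.
    by rewrite !mulr_ge0 ?ler0n ?cylinder_ge0 ?exprn_ge0 ?p_nonneg.
  by have := ler_wpM2l c0 P0; have := ler_wpM2l c1 P1; lra.
have ru0 : 0 < (residual H u)%:R :> R by rewrite ltr0n lt0n.
rewrite -(ler_pM2l ru0) mass_reveal; apply: le_trans (ler_sum _ step) _.
set N := #|completions H|%:R; set r := (residual H u)%:R.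
(* Every edge is charged the worst factor and the savings at fresh vertices are subtracted. Only
   edges to fresh vertices then need an estimate, and only from below, as [edge_lower] provides. *)
have -> : \sum_(w | [set u; w] \notin H) #|completions ([set u; w] |: H)|%:R * M *
      (if w \in W then expR (theta * 2) else gain w)
  = r * N * M * expR (theta * 2) - \sum_(w | w \notin W)
      #|completions ([set u; w] |: H)|%:R * M * (expR (theta * 2) - gain w).
  have := sum_reveal d H u (fun _ => 1 : R); rewrite sumr_const -/N -/r => <-.
  under [X in X * M * _]eq_bigr => w _ do rewrite sumr_const.
  rewrite !mulr_suml [in RHS]big_mkcond [X in _ = _ - X]big_mkcond -sumrB /=.
  rewrite big_mkcond; apply: eq_bigr => w _.
  case: ifPn => uwH; last first.
    rewrite (_ : w \in W) ?subrr //.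
    by move: uwH; rewrite negbK => /HW/fintype.subsetP; apply; rewrite set22.
  by case: (w \in W); rewrite ?subr0 //=; ring.
have WT' : (#|W| <= T)%N by apply: leq_trans WT; rewrite leq_addr.
have HT' : (#|H| <= T)%N by apply: leq_trans HT; rewrite leq_addr.
have c0 : 0 <= r * N * M by rewrite (mulr_ge0 _ M0) // mulr_ge0 ?ler0n.
have dr := ler_wpM2l c0 (edge_drift WT').
apply: (@le_trans _ _ (r * N * M * lambda)); last first.
  by rewrite le_eqVlt /M exprSr; apply/orP; left; apply/eqP; ring.
apply: le_trans dr; rewrite [leRHS]mulrBr lerD2l lerN2 mulr_sumr.
apply: ler_sum => w wW; rewrite mulrA ler_wpM2r ?subr_ge0 ?gain_le //.
have uw : u != w by apply: contraNneq wW => <-.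
have := edge_lower HT' uw (pair_fresh u HW wW).
rewrite {2}/residual (deg_fresh HW wW) subn0 -/N -/r => /(ler_wpM2r M0).
by lra.
Qed.

Lemma supercritical_bound (perc : percolation R) :
  (forall G E, perc n G E = \sum_(S | F G S == E) coin_weight p S) ->
  (0 < #|graphs_of d|)%N ->
  prob perc d A <= expR (theta * Y0%:R) * lambda ^+ T.
Proof.
move=> percE N0; rewrite (prob_coins _ _ percE).
have N0R : 0 < #|graphs_of d|%:R :> R by rewrite ltr0n.
rewrite ler_pdivrMl //.
have E0 : completions finset.set0 = graphs_of d.
  by apply/setP => G; rewrite finset.in_set finset.sub0set andbT.
have HX : explored finset.set0 finset.set0 finset.set0 finset.set0 finset.set0.
  split=> [//|e|c|//|G S _ _]; rewrite ?inE //.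
  by split=> [u|u v]; rewrite inE.
have := mass_bound (t := T) HX; rewrite !cards0 add0n leqnn => /(_ isT isT).
rewrite /mass E0 /cylinder big_set0 mulr1 /boundary big_set0 /potential subr0.
apply: le_trans; apply: ler_sum => G _; rewrite le_eqVlt; apply/orP; left; apply/eqP.
by apply: eq_bigl => S; rewrite finset.setI0 eqxx.
Qed.

End Supercritical.

(** * Left derivatives of generating functions *)

Section LeftDerivative.
Set Implicit Arguments.
Unset Strict Implicit.

Variable R : realType.
Implicit Types (c u v : nat -> R) (x y s : R).

Lemma dominated_tail u v (lu lv : R) N :
  series u @ \oo --> lu -> series v @ \oo --> lv ->
  (forall i, `|u i| <= v i) -> `|lu - series u N| <= lv - series v N.
Proof.
move=> cu cv uv.
have cu' : (fun k => `|series u k - series u N|) @ \oo --> `|lu - series u N|.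
  by apply: cvg_norm; apply: cvgB => //; apply: cvg_cst.
have cv' : (fun k => series v k - series v N) @ \oo --> lv - series v N.
  by apply: cvgB => //; apply: cvg_cst.
apply: ler_cvg_to cu' cv' _; near=> k.
have Nk : (N <= k)%N by near: k; exists N.
by rewrite !sub_series_geq //; apply: le_trans (ler_norm_sum _ _ _) _; apply: ler_sum.
Unshelve. all: by end_near. Qed.

Lemma ler_norm_subX x y i : 0 <= x <= 1 -> 0 <= y <= 1 ->
  `|x ^+ i - y ^+ i| <= i%:R * `|x - y|.
Proof.
move=> /andP[x0 x1] /andP[y0 y1]; elim: i => [|i IH].
  by rewrite subrr normr0 mul0r.
have -> : x ^+ i.+1 - y ^+ i.+1 = x * (x ^+ i - y ^+ i) + (x - y) * y ^+ i.
  by rewrite !exprS; ring.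
apply: le_trans (ler_normD _ _) _; rewrite !normrM -natr1 mulrDl mul1r.
apply: lerD; last by rewrite ler_piMr // ger0_norm ?exprn_ge0 // exprn_ile1.
by apply: le_trans IH; rewrite ler_piMl // ger0_norm.
Qed.

Lemma cvg_pseries_diffs c x : cvgn (pseries (pseries_diffs c) x) ->
  series (fun i => i%:R * c i * x ^+ i.-1) @ \oo
    --> generating_function (pseries_diffs c) x.
Proof.
move=> cx; rewrite -cvg_shiftS.
rewrite (_ : (fun _ => _) = pseries (pseries_diffs c) x); first exact: cx.
apply/funext => k; rewrite /pseries /series /= big_nat_recl // !mul0r add0r.
by apply: eq_bigr.
Qed.

(** The point 1 may lie on the boundary of the disc of convergence. The series is split into a
    polynomial, which is differentiable, and a tail whose difference quotients are bounded by the
    tail of the series of [i%:R * c i], uniformly in the increment. *)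
Lemma cvg_left_quotient c s : (forall i, 0 <= c i) -> cvgn (series c) ->
  cvgn (series (pseries_diffs c)) -> 0 < s <= 1 ->
  (generating_function c (s + h) - generating_function c s) / h
    @[h --> (0 : R)^'-] --> generating_function (pseries_diffs c) s.
Proof.
move=> c0 cc cdc /andP[s0 s1].
have X1 x i : 0 <= x <= 1 -> 0 <= x ^+ i <= 1.
  by case/andP => x0 x1; rewrite exprn_ge0 //= exprn_ile1.
have d0 i : 0 <= pseries_diffs c i by rewrite mulr_ge0.
have dom (a : nat -> R) x : (forall i, 0 <= a i) -> cvgn (series a) -> 0 <= x <= 1 ->
    cvgn (pseries a x).
  move=> a0 ca x01; apply: (series_le_cvg _ a0 _ ca) => i.
    by case/andP: (X1 x i x01) => xi _; rewrite mulr_ge0.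
  by case/andP: (X1 x i x01) => _; apply: ler_piMr.
pose u i := i%:R * c i.
have u0 i : 0 <= u i by rewrite mulr_ge0.
have cu : series u @ \oo --> generating_function (pseries_diffs c) 1.
  rewrite (_ : u = fun i => i%:R * c i * 1 ^+ i.-1).
    apply: cvg_pseries_diffs; apply: dom => //.
    by rewrite ler01 lexx.
  by apply/funext => i; rewrite expr1n mulr1.
have s01 : 0 <= s <= 1 by rewrite (ltW s0).
have cs := cvg_pseries_diffs (dom _ _ d0 cdc s01).
set L := generating_function c; set D := generating_function _ s in cs *.
set M := generating_function _ 1 in cu.
apply/cvgrPdist_le => e e0.
have e3 : 0 < e / 3 by rewrite divr_gt0.
(* The cut is made for the series at 1, which dominates all those on [0, 1]. *)
have [N uN] : exists N, M - series u N <= e / 3.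
  have /cvgrPdist_le/(_ _ e3)[N _ /(_ N (leqnn N))] := cu.
  by exists N; apply: le_trans (ler_norm _) _.
pose P : {poly R} := \poly_(i < N) c i.
have PE x : P.[x] = series (fun i => c i * x ^+ i) N.
  by rewrite horner_poly /series /= big_mkord.
have P'E x : P^`().[x] = series (fun i => i%:R * c i * x ^+ i.-1) N.
  rewrite /series /= big_mkord /P poly_def raddf_sum horner_sum.
  apply: eq_bigr => i _ /=; rewrite derivZ derivXn !hornerE.
  by rewrite hornerMn hornerXn -mulr_natl mulrCA mulrA.
have DP : `|D - P^`().[s]| <= e / 3.
  rewrite P'E; apply: le_trans uN; apply: (dominated_tail N cs cu) => i.
  have /andP[xi0 xi1] := X1 s i.-1 s01.
  by rewrite -/(u i) ger0_norm ?mulr_ge0 // ler_piMr.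
have LP x : 0 <= x <= 1 -> `|(L x - L s) - (P.[x] - P.[s])| <= `|x - s| * (e / 3).
  move=> x01; rewrite !PE.
  have cL : series (fun i => c i * x ^+ i - c i * s ^+ i) @ \oo --> L x - L s.
    rewrite (_ : series _ = pseries c x - pseries c s); last first.
      by apply/funext => k; rewrite /series /= sumrB.
    by apply: cvgB; apply: dom.
  have cv : series (fun i => `|x - s| * u i) @ \oo --> `|x - s| * M.
    rewrite (_ : series _ = (fun k => `|x - s| * series u k)).
      by apply: cvgMr.
    by apply/funext => k; rewrite /series /= mulr_sumr.
  have := dominated_tail N cL cv; rewrite {1}/series /= sumrB => LN.
  apply: le_trans (LN _) _ => [i|].
    rewrite -mulrBr normrM (ger0_norm (c0 i)) /u.
    by have := ler_wpM2l (c0 i) (ler_norm_subX i x01 s01); lra.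
  rewrite {1}/series /= -mulr_sumr -mulrBr ler_wpM2l //.
have cP : (P.[s + h] - P.[s]) / h @[h --> (0 : R)^'-] --> P^`().[s].
  have [dP vP] := is_derive_poly P s.
  rewrite (_ : (fun h => _) = fun h => h^-1 *: ((horner P \o shift s) (h *: 1) - P.[s])).
    by apply: cvg_dnbhs_at_left; rewrite -vP; exact: dP.
  by apply/funext => h /=; rewrite [h *: 1]mulr1 (addrC h) mulrC.
have nearP : \forall h \near (0 : R)^'-, `|P^`().[s] - (P.[s + h] - P.[s]) / h| <= e / 3.
  by move/cvgrPdist_le : cP; apply.
near=> h.
have h0 : h < 0 by near: h; exact: nbhs_left_lt.
have hs : - s < h by near: h; apply: nbhs_left_gt; rewrite oppr_lt0.
have sh : 0 <= s + h <= 1 by apply/andP; split; lra.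
have := LP _ sh; rewrite (_ : s + h - s = h) => [Lh|]; last by ring.
have hn : 0 < `|h| by rewrite normr_gt0 lt_eqF.
have Lh' : `|(L (s + h) - L s) / h - (P.[s + h] - P.[s]) / h| <= e / 3.
  by rewrite -mulrBl normrM normfV ler_pdivrMr // mulrC.
have Ph : `|P^`().[s] - (P.[s + h] - P.[s]) / h| <= e / 3 by near: h.
rewrite (_ : D - _ = (D - P^`().[s]) + (P^`().[s] - (P.[s + h] - P.[s]) / h)
  - ((L (s + h) - L s) / h - (P.[s + h] - P.[s]) / h)); last by ring.
apply: le_trans (ler_normB _ _) _; apply: le_trans (lerD (ler_normD _ _) (lexx _)) _.
by move: DP Lh' Ph; lra.
Unshelve. all: by end_near. Qed.

Lemma left_derive_generating c s : (forall i, 0 <= c i) -> cvgn (series c) ->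
  cvgn (series (pseries_diffs c)) -> 0 < s <= 1 ->
  left_derive (generating_function c) s = generating_function (pseries_diffs c) s.
Proof. by move=> *; apply: cvg_lim => //; apply: cvg_left_quotient. Qed.

Lemma left_derive2_generating c : (forall i, 0 <= c i) -> cvgn (series c) ->
  cvgn (series (pseries_diffs c)) -> cvgn (series (pseries_diffs (pseries_diffs c))) ->
  left_derive (left_derive (generating_function c)) 1
  = generating_function (pseries_diffs (pseries_diffs c)) 1.
Proof.
move=> c0 cc cc1 cc2; have d0 i : 0 <= pseries_diffs c i by rewrite mulr_ge0.
have one : 0 < (1 : R) <= 1 by rewrite ltr01 lexx.
apply: cvg_lim => //.
have := cvg_left_quotient d0 cc1 cc2 one; apply: cvg_trans; apply: near_eq_cvg.
near=> h.
have h0 : h < 0 by near: h; exact: nbhs_left_lt.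
have hs : - 1 < h by near: h; apply: nbhs_left_gt; rewrite oppr_lt0.
by rewrite !left_derive_generating //; apply/andP; split; lra.
Unshelve. all: by end_near. Qed.

End LeftDerivative.

(** * Moments of the degree sequence *)

Section DegreeMoments.
Set Implicit Arguments.
Unset Strict Implicit.

Variables (R : realType) (d : forall n, n.-tuple nat) (lam : nat -> R).
Hypothesis d_sparse : sparse d lam.
Implicit Types (f : nat -> R) (B k n : nat).

Lemma sum_degree_count n (t : n.-tuple nat) f B :
  \sum_(v < n | (tnth t v < B)%N) f (tnth t v)
  = \sum_(0 <= i < B) f i * (degree_count t i)%:R.
Proof.
have -> : \sum_(0 <= i < B) f i * (degree_count t i)%:R
    = \sum_(0 <= i < B) \sum_(v < n) (if i == tnth t v then f i else 0).
  apply: eq_bigr => i _; rewrite -big_mkcond /= sumr_const mulr_natr.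
  by congr (_ *+ _); apply: eq_card => v; rewrite !inE unfold_in eq_sym.
rewrite exchange_big big_mkcond /=; apply: eq_bigr => v _.
by rewrite -big_mkcond big_nat1_eq leq0n.
Qed.

Lemma cvg_truncated_mean f B :
  (\sum_(v < n | (tnth (d n) v < B)%N) f (tnth (d n) v)) / n%:R
    @[n --> \oo] --> \sum_(0 <= i < B) f i * lam i.
Proof.
pose mean n := \sum_(0 <= i < B) f i * ((degree_count (d n) i)%:R / n%:R).
have -> : (fun n => (\sum_(v < n | (tnth (d n) v < B)%N) f (tnth (d n) v)) / n%:R) = mean.
  apply/funext => n; rewrite sum_degree_count mulr_suml.
  by apply: eq_bigr => i _; rewrite mulrA.
rewrite {}/mean; elim: B => [|B IH].
  rewrite [X in _ --> X]big_nil.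
  rewrite (_ : (fun n => _) = cst 0); first exact: cvg_cst.
  by apply/funext => n; rewrite big_nil.
rewrite [X in _ --> X]big_nat_recr //=.
rewrite (_ : (fun n => _) = (fun n => \sum_(0 <= i < B) f i * ((degree_count (d n) i)%:R / n%:R)
    + f B * ((degree_count (d n) B)%:R / n%:R))); last first.
  by apply/funext => n; rewrite big_nat_recr.
by apply: cvgD => //; apply: cvgMr; have [/(_ B)[_]] := d_sparse.
Qed.

Arguments cvg_truncated_mean : clear implicits.

Definition tail_sqr n B : R := \sum_(v < n | (B <= tnth (d n) v)%N) (tnth (d n) v)%:R ^+ 2.

Let q i : R := i%:R * (i%:R - 2).

Lemma sum_excess n : \sum_(v < n) q (tnth (d n) v)
  = \sum_(1 <= i < (max_degree (d n)).+1) q i * (degree_count (d n) i)%:R.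
Proof.
transitivity (\sum_(v < n | (tnth (d n) v < (max_degree (d n)).+1)%N) q (tnth (d n) v)).
  by apply: eq_bigl => v; rewrite ltnS /max_degree leq_bigmax.
rewrite sum_degree_count big_nat_recl // [q 0]mul0r mul0r add0r.
by rewrite big_add1.
Qed.

(** The means of [q] converge to its full sum against [lam], and the truncated means to the
    truncated sums. The contribution of large degrees is the difference, hence small; the three
    errors of [e / 9] are multiplied by 3 in passing from [q] to squares. *)
Lemma uniformly_square_integrable (e : R) : 0 < e ->
  exists B, \forall n \near \oo, tail_sqr n B <= e * n%:R.
Proof.
move=> e0; have [_ _ [l cl cs]] := d_sparse.
have e9 : 0 < e / 9 by rewrite divr_gt0.
have /cvgrPdist_le/(_ _ e9)[N _ NP] := cs.
(* From degree 3 on, the square of [i] is at most [3 * q i]. *)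
pose B := maxn N 3; have B3 : (3 <= B)%N by rewrite leq_maxr.
have lB : `|l - \sum_(1 <= i < B) q i * lam i| <= e / 9 by apply: NP; apply: leq_maxl.
exists B; near=> n.
have n0 : 0 < n%:R :> R by rewrite ltr0n; near: n; exists 1%N.
rewrite -ler_pdivrMr //.
have E1 : `|l - n%:R^-1 * \sum_(v < n) q (tnth (d n) v)| <= e / 9.
  by rewrite sum_excess; near: n; move/cvgrPdist_le : cl; apply.
have E2 : `|\sum_(0 <= i < B) q i * lam i
    - (\sum_(v < n | (tnth (d n) v < B)%N) q (tnth (d n) v)) / n%:R| <= e / 9.
  by near: n; move/cvgrPdist_le : (cvg_truncated_mean q B); apply.
have E0 : \sum_(0 <= i < B) q i * lam i = \sum_(1 <= i < B) q i * lam i.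
  by rewrite big_ltn 1?(ltn_trans _ B3) // [q 0]mul0r mul0r add0r.
have E3 : tail_sqr n B <= 3 * \sum_(v < n | (B <= tnth (d n) v)%N) q (tnth (d n) v).
  rewrite mulr_sumr; apply: ler_sum => v Bv.
  have : 3 <= (tnth (d n) v)%:R :> R by rewrite (ler_nat _ 3) (leq_trans B3).
  by rewrite /q; nra.
have E4 : \sum_(v < n) q (tnth (d n) v) = \sum_(v < n | (tnth (d n) v < B)%N) q (tnth (d n) v)
    + \sum_(v < n | (B <= tnth (d n) v)%N) q (tnth (d n) v).
  by rewrite (bigID (fun v => tnth (d n) v < B)%N) /=; under [X in _ + X]eq_bigl do rewrite -leqNgt.
rewrite E0 in E2; move: E1; rewrite E4 mulrDr mulrC => E1.
apply: le_trans (_ : 3 * (n%:R^-1 * \sum_(v < n | (B <= tnth (d n) v)%N) q (tnth (d n) v)) <= _).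
  by rewrite [leLHS]mulrC [leRHS]mulrCA ler_wpM2l ?invr_ge0 ?(ltW n0).
move: lB E1 E2; rewrite !ler_norml => /andP[lB1 lB2] /andP[E11 E12] /andP[E21 E22].
by move: lB1 lB2 E11 E12 E21 E22; lra.
Unshelve. all: by end_near. Qed.

Section Moment.
Variable f : nat -> R.
Hypothesis f_bound : forall i, 0 <= f i <= i%:R ^+ 2.

Let S k := \sum_(0 <= i < k) f i * lam i.

Lemma mean_tail n B : \sum_(v < n) f (tnth (d n) v)
  <= \sum_(v < n | (tnth (d n) v < B)%N) f (tnth (d n) v) + tail_sqr n B.
Proof.
rewrite (bigID (fun v => tnth (d n) v < B)%N) /= lerD2l.
under eq_bigl do rewrite -leqNgt.
by apply: ler_sum => v _; case/andP: (f_bound (tnth (d n) v)).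
Qed.

Lemma mean_truncated_le n k : \sum_(v < n | (tnth (d n) v < k)%N) f (tnth (d n) v)
  <= \sum_(v < n) f (tnth (d n) v).
Proof.
rewrite [leRHS](bigID (fun v => tnth (d n) v < k)%N) /= lerDl.
by apply: sumr_ge0 => v _; case/andP: (f_bound (tnth (d n) v)).
Qed.

Lemma partial_moment_le (e : R) B k : 0 < e ->
  (\forall n \near \oo, tail_sqr n B <= e * n%:R) -> S k <= S B + e.
Proof.
move=> e0 eB.
have cB : (\sum_(v < n | (tnth (d n) v < B)%N) f (tnth (d n) v)) / n%:R + e @[n --> \oo]
    --> S B + e.
  by apply: cvgD; [exact: cvg_truncated_mean|exact: cvg_cst].
have ck : (\sum_(v < n | (tnth (d n) v < k)%N) f (tnth (d n) v)) / n%:R @[n --> \oo] --> S k.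
  exact: cvg_truncated_mean.
apply: (ler_cvg_to ck cB); near=> n.
have n0 : 0 < n%:R :> R by rewrite ltr0n; near: n; exists 1%N.
rewrite /= ler_pdivrMr // mulrDl mulfVK ?gt_eqF //.
apply: le_trans (mean_truncated_le _ _) _; apply: le_trans (mean_tail _ B) _.
by rewrite lerD2l; near: n.
Unshelve. all: by end_near. Qed.

(** Uniform square integrability permits exchanging the limit in [n] with the sum over degrees for
    every weight dominated by the square. It is applied to the first two factorial moments, which
    are the left derivatives at 1. *)
Lemma moment_cvg : exists2 s : R, S @ \oo --> s &
  (\sum_(v < n) f (tnth (d n) v)) / n%:R @[n --> \oo] --> s.
Proof.
have l0 i : 0 <= lam i by have [/(_ i)[/andP[]]] := d_sparse.
have S_nd : nondecreasing_seq S.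
  apply/nondecreasing_seqP => k; rewrite /S big_nat_recr //= lerDl mulr_ge0 //.
  by case/andP: (f_bound k).
have cS : cvgn S.
  apply: nondecreasing_is_cvgn => //.
  have [B BP] := uniformly_square_integrable ltr01.
  by exists (S B + 1) => _ [k _ <-]; apply: partial_moment_le.
exists (limn S) => //; apply/cvgrPdist_le => e e0.
have e3 : 0 < e / 3 by rewrite divr_gt0.
have [B BP] := uniformly_square_integrable e3.
have SB1 : S B <= limn S by apply: nondecreasing_cvgn_le.
have SB2 : limn S <= S B + e / 3.
  by apply: limr_le => //; apply: nearW => k; apply: partial_moment_le.
near=> n.
have n0 : 0 < n%:R :> R by rewrite ltr0n; near: n; exists 1%N.
have E1 : `|S B - (\sum_(v < n | (tnth (d n) v < B)%N) f (tnth (d n) v)) / n%:R| <= e / 3.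
  by near: n; move/cvgrPdist_le : (cvg_truncated_mean f B); apply.
have E2 : tail_sqr n B <= e / 3 * n%:R by near: n.
have E3 : (\sum_(v < n) f (tnth (d n) v)) / n%:R
   <= (\sum_(v < n | (tnth (d n) v < B)%N) f (tnth (d n) v)) / n%:R + e / 3.
  rewrite ler_pdivrMr // mulrDl mulfVK ?gt_eqF //.
  by apply: le_trans (mean_tail _ B) _; rewrite lerD2l.
have E4 : (\sum_(v < n | (tnth (d n) v < B)%N) f (tnth (d n) v)) / n%:R
    <= (\sum_(v < n) f (tnth (d n) v)) / n%:R.
  by rewrite ler_wpM2r ?invr_ge0 ?(ltW n0) // mean_truncated_le.
move: E1; rewrite !ler_norml => /andP[E11 E12].
by apply/andP; split; lra.
Unshelve. all: by end_near. Qed.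

End Moment.

Let dL := left_derive (generating_function lam) 1.
Let d2L := left_derive (left_derive (generating_function lam)) 1.

Lemma pseries1 c : pseries c (1 : R) = series c.
Proof.
by apply/funext => k; rewrite /pseries /series; apply: eq_bigr => i _ /=; rewrite expr1n mulr1.
Qed.

Lemma degree_moments :
  (\sum_(v < n) tnth (d n) v)%:R / n%:R @[n --> \oo] --> dL /\
  (\sum_(v < n) tnth (d n) v * (tnth (d n) v).-1)%:R / n%:R @[n --> \oo] --> d2L.
Proof.
have [l0 l1 _] := d_sparse.
have lam0 i : 0 <= lam i by have [/andP[]] := l0 i.
have cl : cvgn (series lam) by apply/cvg_ex; exists 1.
have f1 i : 0 <= (i%:R : R) <= i%:R ^+ 2.
  by rewrite ler0n -natrX ler_nat /=; case: i => // i; rewrite leq_pmulr.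
have f2 i : 0 <= ((i * i.-1)%:R : R) <= i%:R ^+ 2.
  by rewrite ler0n -natrX ler_nat /= -mulnn leq_mul2l leq_pred orbT.
have [s1 cs1 cm1] := moment_cvg f1.
have [s2 cs2 cm2] := moment_cvg f2.
have c1 : series (pseries_diffs lam) @ \oo --> s1.
  rewrite (_ : series _ = (fun k => \sum_(0 <= i < k.+1) i%:R * lam i)).
    by rewrite (cvg_shiftS (fun k => \sum_(0 <= i < k) i%:R * lam i)).
  by apply/funext => k; rewrite big_nat_recl // mul0r add0r.
have c2 : series (pseries_diffs (pseries_diffs lam)) @ \oo --> s2.
  rewrite (_ : series _ = (fun k => \sum_(0 <= i < k.+2) (i * i.-1)%:R * lam i)).
    rewrite (cvg_shiftS (fun k => \sum_(0 <= i < k.+1) (i * i.-1)%:R * lam i)).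
    by rewrite (cvg_shiftS (fun k => \sum_(0 <= i < k) (i * i.-1)%:R * lam i)).
  apply/funext => k; rewrite big_nat_recl // mul0r add0r big_nat_recl // mul0r add0r.
  by apply: eq_bigr => i _; rewrite /pseries_diffs natrM /=; ring.
have one : 0 < (1 : R) <= 1 by rewrite ltr01 lexx.
have cc1 : cvgn (series (pseries_diffs lam)) by apply/cvg_ex; exists s1.
have cc2 : cvgn (series (pseries_diffs (pseries_diffs lam))) by apply/cvg_ex; exists s2.
have -> : dL = s1.
  rewrite /dL left_derive_generating // /generating_function pseries1.
  exact: cvg_lim.
have -> : d2L = s2.
  rewrite /d2L left_derive2_generating // /generating_function pseries1.
  exact: cvg_lim.
by split; under [X in X @ _ --> _]eq_fun do rewrite natr_sum.
Qed.

End DegreeMoments.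

(** * Growth of the maximum degree *)

Section MaxDegree.
Set Implicit Arguments.
Unset Strict Implicit.

Variables (R : realType) (d : forall n, n.-tuple nat).
Hypothesis d_max : forall n : nat, (0 < n)%N ->
  (max_degree (d n))%:R <= n%:R `^ (1 / 9) :> R.

Lemma max_degree_sqr_small (e : R) : 0 < e ->
  \forall n \near \oo, (2 * ((max_degree (d n)).+2 * (max_degree (d n)).+2))%:R <= e * n%:R.
Proof.
(* If [D.+2] exceeds [A], then [D.+2 <= 3 * D], and [2 * D.+2 ^ 3 <= 54 * D ^ 3 <= 54 * n], whence
   54; otherwise the left side is bounded. *)
move=> e0; pose A := (Num.truncn (54 / e)).+3.
have Ae : 54 <= e * A%:R.
  rewrite mulrC -ler_pdivrMr //; apply: le_trans (ltW (truncnS_gt _)) _.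
  by rewrite ler_nat; apply: leq_trans (leqnSn _) (leqnSn _).
near=> n.
have n0 : (0 < n)%N by near: n; exists 1%N.
set D := max_degree (d n).
have [DA|AD] := leqP D.+2 A.
  apply: (@le_trans _ _ (2 * (A * A))%:R).
    by rewrite ler_nat leq_mul2l leq_mul.
  rewrite mulrC -ler_pdivrMr //; near: n; exact: nbhs_infty_ger.
have D0 : (0 < D)%N by rewrite /A in AD; lia.
have Dn : (D ^ 9 <= n)%N.
  rewrite -(ler_nat R) natrX; apply: (@le_trans _ _ ((n%:R `^ (1 / 9)) ^+ 9)).
    by rewrite lerXn2r ?nnegrE ?powR_ge0 ?ler0n // d_max.
  by rewrite -powR_mulrn ?powR_ge0 // -powRrM mul1r mulVf ?powRr1 ?ler0n ?pnatr_eq0.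
have D3 : (D ^ 3 <= n)%N by apply: leq_trans Dn; rewrite leq_pexp2l.
have K : (2 * (D.+2 * D.+2) * A <= 54 * n)%N.
  apply: (@leq_trans (2 * (D.+2 * D.+2) * D.+2)); first by rewrite leq_mul2l ltnW ?orbT.
  apply: (@leq_trans (54 * D ^ 3)); last by rewrite leq_mul2l D3 orbT.
  have D3' : (D.+2 <= 3 * D)%N by lia.
  apply: (@leq_trans (2 * ((3 * D) * (3 * D)) * (3 * D))).
    by rewrite leq_mul // leq_mul2l leq_mul.
  by rewrite !expnS expn0; lia.
have A0 : 0 < A%:R :> R by rewrite ltr0n.
rewrite -(ler_pM2r A0) -natrM; apply: le_trans (_ : (54 * n)%:R <= _); first by rewrite ler_nat.
rewrite natrM mulrAC ler_wpM2r //.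
Unshelve. all: by end_near. Qed.

End MaxDegree.

(** * Drift, edge probabilities and the critical value *)

Section Estimates.
Set Implicit Arguments.
Unset Strict Implicit.
Local Open Scope set_scope.
Local Open Scope bool_scope.

Variable R : realType.

(** From [expR (- x) >= 1 - x] one gets [expR x <= 1 / (1 - x)], and
    [(1 - x) * (1 + x + 2 * x ^+ 2)] equals [1 + x ^+ 2 * (1 - 2 * x)]. *)
Lemma expR_le_quadratic (x : R) : x <= 2^-1 -> expR x <= 1 + x + 2 * x ^+ 2.
Proof.
move=> x2; have x1 : 0 < 1 - x by lra.
have := expR_ge1Dx (- x); rewrite expRN => ex.
have : expR x * (1 - x) <= 1.
  by rewrite mulrC -ler_pdivlMr ?expR_gt0 // div1r.
have x0 : 0 <= x ^+ 2 * (1 - 2 * x) by rewrite mulr_ge0 ?sqr_ge0 //; lra.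
move=> ex1; rewrite -(ler_pM2r x1); apply: le_trans ex1 _.
by move: x0; rewrite !expr2; lra.
Qed.

Section Degrees.
Variables (n : nat) (d : n.-tuple nat).
Implicit Types (H : graph n) (u v w : 'I_n) (W : {set 'I_n}).

(** Here [b] is slightly below the inverse of the degree sum, and the relative loss [g] absorbs both
    error terms of [switch_lower]. *)
Lemma card_completions_lower Delta T H u w (b g : R) :
  (forall v, tnth d v <= Delta)%N -> (#|H| <= T)%N -> u != w -> [set u; w] \notin H ->
  0 <= b -> b * (\sum_v tnth d v)%:R <= 1 - g -> 0 <= g ->
  0 < (\sum_v tnth d v)%:R - (2 * T)%:R :> R ->
  (3 * (Delta.+2 * Delta.+2))%:R <= g * ((\sum_v tnth d v)%:R - (2 * T)%:R) ->
  #|completions d H|%:R * (residual d H u)%:R * ((residual d H w)%:R * b)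
  <= #|completions d ([set u; w] |: H)|%:R.
Proof.
(* The invalid choices of the switching, and the product of two residual degrees, together. *)
have DD D : (2 * (D.+2 * D) + D * D <= 3 * (D.+2 * D.+2))%N by clear; lia.
move=> dD HT uw uwH b0 bM g0 m0 gm.
have [->|/card_gt0P[G GC]] := posnP #|completions d H|; first by rewrite !mul0r.
have sr := sum_residual GC.
have mE : (\sum_v residual d H v)%:R = (\sum_v tnth d v)%:R - (2 * #|H|)%:R :> R.
  by rewrite -sr natrD addrK.
have HT2 : (2 * #|H|)%:R <= (2 * T)%:R :> R by rewrite ler_nat leq_mul2l HT orbT.
have := switch_lower uw uwH dD; rewrite -(ler_nat R) !(natrD, natrM, natrX) -natrM.
set m : R := (\sum_v _)%:R in mE *.
set M : R := (\sum_v tnth d v)%:R in bM m0 gm mE.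
set N : R := #|completions d H|%:R; set N1 : R := #|completions d _|%:R.
set r := (_ * _)%N => sw.
have rD : r%:R <= (Delta * Delta)%:R :> R.
  by rewrite ler_nat leq_mul // (leq_trans (leq_subr _ _)).
have mM : m <= M by rewrite mE lerBlDr lerDl.
have m1 : 0 < m by move: m0 HT2; rewrite mE; lra.
have cm : (3 * (Delta.+2 * Delta.+2))%:R <= g * m.
  by apply: le_trans gm _; rewrite ler_wpM2l // mE; move: HT2; lra.
pose D2 : R := (Delta * Delta)%:R; pose c : R := (2 * (Delta.+2 * Delta))%:R.
have cD : c + D2 <= g * m.
  by apply: le_trans cm; rewrite -natrD ler_nat.
have D20 : 0 <= D2 by exact: ler0n.
have N0 : 0 <= N by exact: ler0n.
have N10 : 0 <= N1 by exact: ler0n.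
have r0 : 0 <= r%:R :> R by exact: ler0n.
have bm : b * m <= 1 - g by apply: le_trans bM; rewrite ler_wpM2l.
have mD : 0 < m * (m + D2) by rewrite mulr_gt0 // ltr_wpDr.
rewrite (_ : N * _ * _ = N * r%:R * b); last by rewrite /r natrM; ring.
rewrite -(ler_pM2r mD).
have Nr : 0 <= N * r%:R by rewrite mulr_ge0.
have H1 : N * r%:R * (b * m * (m + D2)) <= N * r%:R * (m - c).
  rewrite ler_wpM2l //; apply: le_trans (_ : (1 - g) * (m + D2) <= _).
    by rewrite ler_wpM2r // addr_ge0 // ltW.
  by have : 0 <= g * D2 by [rewrite mulr_ge0]; move: cD; lra.
have H2 : N * r%:R * (m - c) <= N1 * (m * (m + D2)).
  have : N1 * (r%:R * m) <= N1 * (D2 * m) by rewrite ler_wpM2l // ler_wpM2r // ltW.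
  by move: sw; rewrite /c !natrM expr2; lra.
by move: H1 H2; lra.
Qed.

(** Vertices of degree below [B] contribute at most [B ^ 2] each, the others belong to the tail. It
    serves both for the visited vertices and for a small component. *)
Lemma sum_sqr_small W (B : nat) (e s : R) :
  \sum_(v < n | (B <= tnth d v)%N) (tnth d v)%:R ^+ 2 <= e * n%:R ->
  #|W|%:R <= s * n%:R -> B%:R ^+ 2 * s <= e ->
  \sum_(w in W) (tnth d w)%:R ^+ 2 <= 2 * e * n%:R.
Proof.
move=> tl Ws Bs.
have : \sum_(w in W) (tnth d w)%:R ^+ 2 <=
    #|W|%:R * B%:R ^+ 2 + \sum_(v < n | (B <= tnth d v)%N) (tnth d v)%:R ^+ 2 :> R.
  rewrite mulr_natl -sumr_const big_mkcond [X in X + _]big_mkcond [X in _ + X]big_mkcond.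
  rewrite -big_split /=; apply: ler_sum => v _; case: ifP => _; case: ifPn => Bv.
  - by rewrite lerDr sqr_ge0.
  - by rewrite addr0 -!natrX ler_nat leq_exp2r // ltnW // ltnNge.
  - by rewrite add0r sqr_ge0.
  - by rewrite add0r.
have := ler_wpM2r (sqr_ge0 (B%:R : R)) Ws.
have := ler_wpM2r (ler0n R n) Bs.
by move: tl; lra.
Qed.

Lemma ler_nat_sqr (m : nat) : m%:R <= m%:R ^+ 2 :> R.
Proof. by rewrite -natrX ler_nat; case: m => // m; rewrite -mulnn leq_pmulr. Qed.

Lemma sum_degree_outside W :
  (\sum_v tnth d v)%:R - \sum_(w in W) (tnth d w)%:R ^+ 2
  <= \sum_(w | w \notin W) (tnth d w)%:R :> R.
Proof.
rewrite natr_sum lerBlDr (bigID (mem W)) /= addrC lerD2l.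
by apply: ler_sum => v _; apply: ler_nat_sqr.
Qed.

Lemma sum_truncated_outside W (B : nat) :
  (\sum_v tnth d v * (tnth d v).-1)%:R - \sum_(w in W) (tnth d w)%:R ^+ 2
    - \sum_(v < n | (B <= tnth d v)%N) (tnth d v)%:R ^+ 2
  <= \sum_(w | w \notin W) (tnth d w)%:R * ((minn (tnth d w) B)%:R - 1) :> R.
Proof.
rewrite natr_sum !lerBlDr big_mkcond [X in _ <= _ + X]big_mkcond.
rewrite [X in _ <= _ + X + _]big_mkcond [X in _ <= X + _ + _]big_mkcond.
rewrite -!big_split /=; apply: ler_sum => v _; move: (tnth d v) => m.
have -> : (m * m.-1)%:R = m%:R * (m%:R - 1) :> R.
  by case: m => [|m]; rewrite ?mul0r // natrM -(natr1 m) /= addrK.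
have m0 : 0 <= m%:R :> R by [].
have m2 := ler_nat_sqr m.
case: (v \in W) => /=.
  by case: ifP => _; move: m2; rewrite !expr2; nra.
case: leqP => Bm; last by rewrite !addr0.
have B0 : 0 <= B%:R :> R by [].
by have := mulr_ge0 m0 B0; rewrite !expr2; lra.
Qed.

(* The degrees gained are truncated at [B]: the second-order term of the
   exponential would otherwise involve the third moment of the degrees. *)
Lemma drift_bound (p theta b k : R) (B : nat) W :
  0 <= p <= 1 -> 0 <= theta -> 0 <= b ->
  theta * (B%:R + 2) <= 2^-1 -> theta * (2 * (B%:R + 2) ^+ 2) <= k ->
  \sum_(w | w \notin W) (tnth d w)%:R * b <= 1 ->
  2 + 2 * k <= \sum_(w | w \notin W) (tnth d w)%:R * b
     + p * \sum_(w | w \notin W) (tnth d w)%:R * b * ((minn (tnth d w) B)%:R - 1) ->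
  expR (theta * 2) - \sum_(w | w \notin W) (tnth d w)%:R * b *
     (expR (theta * 2) - ((1 - p) * expR theta + p * expR (theta * (2 - (tnth d w)%:R))))
  <= 1 - k * theta.
Proof.
move=> /andP[p0 p1] t0 b0 tB tk.
set C := B%:R + 2 in tB tk; set Q := \sum_(w | _) _ => Q1.
set Z := \sum_(w | _) _ => QZ.
have B0 : 0 <= B%:R :> R by [].
pose E y := 1 + theta * y + theta ^+ 2 * (2 * C ^+ 2).
have eE y : - C <= y <= C -> expR (theta * y) <= E y.
  move=> /andP[y1 y2]; apply: le_trans (expR_le_quadratic _) _.
    by apply: le_trans tB; rewrite ler_wpM2l.
  rewrite /E lerD2l exprMn mulrCA ler_wpM2l ?sqr_ge0 // ler_wpM2l //.
  by rewrite !expr2; nra.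
have gE w : (1 - p) * expR theta + p * expR (theta * (2 - (tnth d w)%:R))
    <= E (1 - p * ((minn (tnth d w) B)%:R - 1)).
  have E1 : expR theta <= E 1.
    by rewrite -[X in expR X]mulr1; apply: eE; rewrite /C; apply/andP; split; lra.
  have E2 : expR (theta * (2 - (tnth d w)%:R)) <= E (2 - (minn (tnth d w) B)%:R).
    apply: le_trans (eE _ _); last first.
      have : (minn (tnth d w) B)%:R <= B%:R :> R by rewrite ler_nat geq_minr.
      have : 0 <= (minn (tnth d w) B)%:R :> R by [].
      by rewrite /C => *; apply/andP; split; lra.
    rewrite ler_expR ler_wpM2l // lerD2l lerN2 ler_nat; exact: geq_minl.
  have p1' : 0 <= 1 - p by lra.
  have := ler_wpM2l p0 E2; have := ler_wpM2l p1' E1; rewrite /E; lra.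
have E2 : expR (theta * 2) <= E 2 by apply: eE; rewrite /C; apply/andP; split; lra.
have sE : \sum_(w | w \notin W) (tnth d w)%:R * b *
     (expR (theta * 2) - ((1 - p) * expR theta + p * expR (theta * (2 - (tnth d w)%:R))))
   >= Q * expR (theta * 2) - (Q * E 1 - theta * p * Z).
  rewrite /Q /Z !mulr_suml mulr_sumr -!sumrB; apply: ler_sum => w _.
  have db : 0 <= (tnth d w)%:R * b by rewrite mulr_ge0.
  by have := ler_wpM2l db (gE w); rewrite /E; lra.
(* With [Q] the chance of a fresh vertex, the first-order coefficient is [2 - Q - p * Z <= - 2 * k];
   the second-order term is at most [k * theta], which leaves [1 - k * theta]. *)
have Q1' : 0 <= 1 - Q by lra.
have := ler_wpM2l Q1' E2; have := ler_wpM2l t0 tk; have := ler_wpM2l t0 QZ.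
by move: sE; rewrite /E expr2; lra.
Qed.

End Degrees.

Lemma prob_compl (perc : percolation R) n (d : n.-tuple nat) (p : R)
    (F : graph n -> graph n -> graph n) (A : pred (graph n)) :
  (forall G E, perc n G E = \sum_(S | F G S == E) coin_weight p S) ->
  (0 < #|graphs_of d|)%N -> prob perc d A = 1 - prob perc d (predC A).
Proof.
move=> percE N0; rewrite !(prob_coins _ _ percE); apply/eqP; rewrite eq_sym subr_eq.
apply/eqP; rewrite -mulrDr -big_split /= (eq_bigr (fun=> 1)) => [|G _].
  by rewrite sumr_const mulVf // pnatr_eq0 -lt0n.
rewrite -big_split /= -[RHS](sum_coin_weight p {set 'I_n}); apply: eq_bigr => S _.
by rewrite -mulrDl; case: (A _); rewrite ?addr0 ?add0r mul1r.
Qed.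

Lemma prob_ge0 (perc : percolation R) n (d : n.-tuple nat) (p : R)
    (F : graph n -> graph n -> graph n) (A : pred (graph n)) :
  0 <= p <= 1 -> (forall G E, perc n G E = \sum_(S | F G S == E) coin_weight p S) ->
  0 <= prob perc d A.
Proof.
move=> p01 percE; rewrite (prob_coins _ _ percE) mulr_ge0 ?invr_ge0 //.
by apply: sumr_ge0 => G _; apply: sumr_ge0 => S _; rewrite mulr_ge0 ?coin_weight_ge0.
Qed.

Lemma prob_L1_ratio (perc : percolation R) n (d : n.-tuple nat) (eps : R) : (0 < n)%N ->
  prob perc d [pred E | eps < `|#|L1 E|%:R / n%:R|]
  = prob perc d [pred E | eps * n%:R < #|L1 E|%:R].
Proof.
move=> n0; have n0R : 0 < n%:R :> R by rewrite ltr0n.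
rewrite /prob; apply: eq_bigr => G _; congr (_ * _); apply: eq_bigl => E /=.
by rewrite ger0_norm ?divr_ge0 // ltr_pdivlMr.
Qed.

Lemma negligible_not_giant (perc : percolation R) (d : forall n, n.-tuple nat) :
  L1_negligible perc d -> ~ L1_giant perc d.
Proof.
move=> small [eps eps0 big]; have : (0 : R) = 1; last by move/eqP; rewrite eq_sym oner_eq0.
rewrite -(cvg_lim _ big) //; apply/esym/cvg_lim => //; apply: cvg_trans (small _ eps0).
apply: near_eq_cvg; near=> n.
by rewrite prob_L1_ratio //; near: n; exists 1%N.
Unshelve. all: by end_near. Qed.

Lemma critical_prob_eq (perc : R -> percolation R) (d : forall n, n.-tuple nat) (c : R) :
  0 < c < 1 ->
  (forall p : R, 0 <= p <= 1 -> p < c -> L1_negligible (perc p) d) ->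
  (forall p : R, 0 <= p <= 1 -> c < p -> L1_giant (perc p) d) ->
  critical_prob perc d = c.
Proof.
move=> /andP[c0 c1] small big; rewrite /critical_prob; set A := [set p : R | _]%classic.
have Ac : ubound A c.
  move=> p [p01 pA]; rewrite leNgt; apply/negP => /(big _ p01).
  exact: negligible_not_giant.
have Ap p : 0 <= p < c -> A p.
  case/andP => p0 pc; have p01 : 0 <= p <= 1 by rewrite p0 ltW // (lt_trans pc).
  by split=> //; apply: small.
have A0 : A 0 by apply: Ap; rewrite lexx.
have ubA : has_ubound A by exists c.
apply/eqP; rewrite eq_le ge_sup //=; last by exists 0.
have s0 : 0 <= sup A by apply: ub_le_sup.
rewrite leNgt; apply/negP => sc.
have : A ((sup A + c) / 2) by apply: Ap; apply/andP; split; lra.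
by move/(ub_le_sup ubA); lra.
Qed.

End Estimates.

(** * The threshold *)

Section Threshold.
Set Implicit Arguments.
Unset Strict Implicit.
Local Open Scope set_scope.
Local Open Scope bool_scope.

Variable R : realType.

Lemma small_component_prob n (t : n.-tuple nat) (perc : percolation R)
    (F : graph n -> graph n -> graph n) coin alive (A : pred (graph n))
    (p b g k theta : R) (Delta T Y0 B : nat) :
  coin_model F coin alive ->
  (forall G E, perc n G E = \sum_(S | F G S == E) coin_weight p S) ->
  (0 < #|graphs_of t|)%N -> (forall v, tnth t v <= Delta)%N ->
  (0 < Y0)%N ->
  (forall E v, A E -> \sum_(u in component E v) tnth t u < Y0)%N ->
  0 <= p <= 1 -> 0 <= theta -> 0 <= k <= p / 2 ->
  theta * (B%:R + 2) <= 2^-1 -> theta * (2 * (B%:R + 2) ^+ 2) <= k ->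
  0 <= b -> 0 <= g -> b * (\sum_v tnth t v)%:R <= 1 - g ->
  0 < (\sum_v tnth t v)%:R - (2 * T)%:R :> R ->
  (3 * (Delta.+2 * Delta.+2))%:R <= g * ((\sum_v tnth t v)%:R - (2 * T)%:R) ->
  (forall W : {set 'I_n}, (#|W| <= T)%N ->
    2 + 2 * k <= \sum_(w | w \notin W) (tnth t w)%:R * b
     + p * \sum_(w | w \notin W) (tnth t w)%:R * b * ((minn (tnth t w) B)%:R - 1)) ->
  prob perc t A <= expR (theta * Y0%:R) * (1 - k * theta) ^+ T.
Proof.
move=> FM percE N0 tD Y00 smallA p01 t0 /andP[k0 kp] tB tk b0 g0 bM m0 gm hW.
have [p0 p1] := andP p01.
have B0 : 0 <= B%:R :> R by [].
have t4 : theta <= 4^-1 by nra.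
have kt0 : 0 <= k * theta by rewrite mulr_ge0.
have kt1 : k * theta <= 1 by nra.
apply: (supercritical_bound p01 FM t0 _ Y00 smallA _ _ _ _ percE N0) => //.
- by apply/andP; split; lra.
- move=> H u w HT uw uwH.
  exact: (card_completions_lower tD HT uw uwH b0 bM g0 m0 gm).
(* If all vertices outside [W] had degree 0, both sums in the drift condition would vanish. *)
- move=> W WT; have := hW W WT; case: (boolP [exists w, (w \notin W) && (0 < tnth t w)%N]).
    by case/existsP => w /andP[wW tw]; exists w.
  move=> /existsPn W0; have {}W0 w : w \notin W -> tnth t w = 0%N.
    by move=> wW; have := W0 w; rewrite wW /= lt0n negbK => /eqP.
  rewrite !big1 => [|w /W0 ->|w /W0 ->]; rewrite ?mul0r //.
  by rewrite mulr0 addr0 leNgt => /negP[]; lra.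
(* As [theta <= 1 / 4], a root trial contracts by at least [p * theta / 2], and [k <= p / 2]. *)
- have : expR (- theta) <= 1 - theta + 2 * (- theta) ^+ 2.
    by apply: expR_le_quadratic; lra.
  rewrite sqrrN expr2 => et; have := ler_wpM2l p0 et.
  have : p * theta * (4 * theta) <= p * theta * 1.
    by rewrite ler_wpM2l ?mulr_ge0 //; lra.
  by have := ler_wpM2r t0 kp; lra.
move=> W WT; apply: (drift_bound p01 t0 b0 tB tk _ (hW W WT)).
apply: le_trans (_ : b * (\sum_v tnth t v)%:R <= _); last by apply: le_trans bM _; rewrite gerBl.
rewrite natr_sum mulr_sumr big_mkcond /=; apply: ler_sum => v _.
by rewrite mulrC; case: ifP => // _; rewrite mulr_ge0.
Qed.

Variables (d : forall n : nat, n.-tuple nat) (lam : nat -> R) (mu nu : R).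
Hypothesis d_graphical : graphical d.
Hypothesis d_sparse : sparse d lam.
Hypothesis d_max : forall n : nat, (0 < n)%N ->
  (max_degree (d n))%:R <= n%:R `^ (1 / 9) :> R.
Hypothesis cvg_mu : (\sum_(v < n) tnth (d n) v)%:R / n%:R @[n --> \oo] --> mu.
Hypothesis cvg_nu :
  (\sum_(v < n) tnth (d n) v * (tnth (d n) v).-1)%:R / n%:R @[n --> \oo] --> nu.
Hypothesis mu_nu : mu < nu.

Lemma graphs_of_gt0 n : (0 < n)%N -> (0 < #|graphs_of (d n)|)%N.
Proof. by move=> /d_graphical[E Ed]; apply/card_gt0P; exists E. Qed.

Lemma degree_le_max n (v : 'I_n) : (tnth (d n) v <= max_degree (d n))%N.
Proof. exact: leq_bigmax. Qed.

(** Degrees up to a bound [B] contribute at most [B * mu] to [nu], and the tail at most [nu / 2]; so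
    [mu = 0] would force [nu <= 0], against [mu < nu]. *)
Lemma mean_degree_gt0 : 0 < mu.
Proof.
have mu0 : 0 <= mu.
  by apply: cvgr_to_ge cvg_mu _; apply: nearW => n; rewrite divr_ge0.
rewrite lt_neqAle mu0 andbT eq_sym; apply/eqP => mu_eq0.
have nu0 : 0 < nu by rewrite -mu_eq0.
have nu2 : 0 < nu / 2 by rewrite divr_gt0.
have [B BP] := uniformly_square_integrable d_sparse nu2.
suff : nu <= B%:R * mu + nu / 2 by rewrite mu_eq0 mulr0; lra.
have cB : B%:R * ((\sum_(v < n) tnth (d n) v)%:R / n%:R) + nu / 2 @[n --> \oo]
    --> B%:R * mu + nu / 2.
  by apply: cvgD; [exact: cvgMr|exact: cvg_cst].
apply: (ler_cvg_to cvg_nu cB); near=> n.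
have n0 : 0 < n%:R :> R by rewrite ltr0n; near: n; exists 1%N.
rewrite ler_pdivrMr // mulrDl -mulrA mulfVK ?gt_eqF //.
apply: le_trans (_ : B%:R * (\sum_(v < n) tnth (d n) v)%:R + tail_sqr R d n B <= _); last first.
  by rewrite lerD2l; near: n.
rewrite !natr_sum mulr_sumr /tail_sqr [X in _ + X]big_mkcond -big_split /=.
apply: ler_sum => v _; case: leqP => Bv.
  by rewrite ler_wpDl ?mulr_ge0 // -natrX ler_nat -mulnn leq_mul2l leq_pred orbT.
rewrite addr0 -natrM ler_nat mulnC leq_mul2r; apply/orP; right.
exact: leq_trans (leq_pred _) (ltnW Bv).
Unshelve. all: by end_near. Qed.

Variables (perc : percolation R) (p : R)
  (F : forall n, graph n -> graph n -> graph n)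
  (coin : forall n, 'I_n -> 'I_n -> {set 'I_n})
  (alive : forall n, graph n -> pred 'I_n).
Hypothesis FM : forall n, coin_model (@F n) (@coin n) (@alive n).
Hypothesis percE : forall n (G E : graph n),
  @perc n G E = \sum_(S | F G S == E) coin_weight p S.
Hypothesis p01 : 0 <= p <= 1.

Lemma subcritical_negligible : p < mu / nu -> L1_negligible perc d.
Proof.
have mu0 := mean_degree_gt0; have nu0 : 0 < nu := lt_trans mu0 mu_nu.
have [p0 p1] := andP p01.
move=> pmu eps eps0; apply/cvgrPdist_le => e e0.
have pnu : p * nu < mu by rewrite -ltr_pdivlMr.
(* Half the gap between [p * nu / mu] and 1, so that [rho] can exceed [nu / mu] with [p * rho] still
   below 1. *)
pose z := (1 - p * nu / mu) / 2.
have z0 : 0 < z by rewrite divr_gt0 // subr_gt0 ltr_pdivrMr // mul1r.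
pose rho := nu / mu + z.
have rho0 : 0 < rho by rewrite /rho addr_gt0 // divr_gt0.
have prho0 : 0 <= p * rho by rewrite mulr_ge0 // ltW.
have prho1 : p * rho < 1.
  have : p * z <= z by rewrite ler_piMl // ltW.
  by move: z0; rewrite /rho /z mulrDr mulrA; lra.
pose y := z * mu.
have y0 : 0 < y by rewrite mulr_gt0.
have rmu : rho * mu = nu + y by rewrite /rho mulrDl mulfVK // gt_eqF.
(* Chosen so that [nu + s <= rho * (mu - 2 * s)], with [mu - 2 * s] positive. *)
pose s := Num.min (y / (1 + 2 * rho)) (mu / 4).
have s0 : 0 < s by rewrite lt_min !divr_gt0 // addr_gt0 // mulr_gt0.
have s_mu : s <= mu / 4 by rewrite ge_min lexx orbT.
have s_y : s * (1 + 2 * rho) <= y.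
  by rewrite -ler_pdivlMr ?addr_gt0 ?mulr_gt0 // ge_min lexx.
pose C := mu + 1.
have C0 : 0 < C by rewrite addr_gt0.
have ee0 : 0 < e * eps ^+ 2 / 2 by rewrite divr_gt0 // mulr_gt0 // exprn_gt0.
(* [k] is fixed before [n]: long paths use half of the allowance, and [1 + C * k%:R] is below the
   other half for large [n]. *)
have [k kP] : exists k, C * (p * rho) ^+ k <= e * eps ^+ 2 / 2.
  have : (fun k => C * (p * rho) ^+ k) @ \oo --> C * 0.
    by apply: cvgMr; apply: cvg_expr; rewrite ger0_norm.
  move/cvgrPdist_le => /(_ _ ee0)[k _ /(_ k (leqnn k))].
  rewrite mulr0 sub0r normrN => kP; exists k.
  exact: le_trans (ler_norm _) kP.
have s2 : 0 < s / 2 by rewrite divr_gt0.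
near=> n.
have n0 : (0 < n)%N by near: n; exists 1%N.
have n0R : 0 < n%:R :> R by rewrite ltr0n.
have E1 : `|mu - (\sum_(v < n) tnth (d n) v)%:R / n%:R| <= s.
  by near: n; move/cvgrPdist_le : cvg_mu; apply.
have E1' : `|mu - (\sum_(v < n) tnth (d n) v)%:R / n%:R| <= 1.
  by near: n; move/cvgrPdist_le : cvg_mu; apply.
have E2 : `|nu - (\sum_(v < n) tnth (d n) v * (tnth (d n) v).-1)%:R / n%:R| <= s.
  by near: n; move/cvgrPdist_le : cvg_nu; apply.
have E3 : (2 * ((max_degree (d n)).+2 * (max_degree (d n)).+2))%:R <= s / 2 * n%:R.
  by near: n; apply: max_degree_sqr_small.
have E4 : (2 * k)%:R <= s / 2 * n%:R.
  by rewrite [leRHS]mulrC -ler_pdivrMr //; near: n; apply: nbhs_infty_ger.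
have E5 : 1 + C * k%:R <= e * eps ^+ 2 / 2 * n%:R.
  by rewrite [leRHS]mulrC -ler_pdivrMr //; near: n; apply: nbhs_infty_ger.
rewrite !ler_distl in E1 E1' E2; move: E1 E1' E2.
set M := (\sum_v _)%:R; set V := (\sum_v _ * _)%:R.
move=> /andP[a1 a2] /andP[a3 _] /andP[b1 _].
have M1 : (mu - s) * n%:R <= M by rewrite -ler_pdivlMr //; move: a2; lra.
have M3 : M <= C * n%:R by rewrite -ler_pdivrMr //; move: a3; rewrite /C; lra.
have V2 : V <= (nu + s) * n%:R by rewrite -ler_pdivrMr //; move: b1; lra.
set D := max_degree (d n) in E3.
have D3 : (2 * (D.+1 * D))%:R <= s / 2 * n%:R.
  apply: le_trans E3; rewrite ler_nat leq_mul2l /=.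
  by apply: leq_mul; [exact: leqnSn|exact: leq_trans (leqnSn _) (leqnSn _)].
have m0M : (mu - 2 * s) * n%:R <= M - (2 * k)%:R - (2 * (D.+1 * D))%:R.
  by move: M1 E4 D3; lra.
have m0_gt0 : 0 < M - (2 * k)%:R - (2 * (D.+1 * D))%:R.
  by apply: lt_le_trans m0M; rewrite mulr_gt0 //; lra.
have rhoM : V <= rho * (M - (2 * k)%:R - (2 * (D.+1 * D))%:R).
  apply: le_trans V2 _; apply: le_trans (_ : rho * ((mu - 2 * s) * n%:R) <= _).
    by rewrite mulrA ler_wpM2r //; move: rmu s_y; lra.
  by rewrite ler_wpM2l // ltW.
have x0 : 0 <= eps * n%:R by rewrite mulr_ge0 // ltW.
have main := subcritical_bound p01 (FM n) (@degree_le_max n) m0_gt0 rhoM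
  (ltW prho1) x0 (@percE n) (graphs_of_gt0 n0).
rewrite sub0r normrN ger0_norm; last exact: (prob_ge0 _ _ p01 (@percE n)).
rewrite prob_L1_ratio //.
have x2 : 0 < (eps * n%:R) ^+ 2 by rewrite exprn_gt0 // mulr_gt0.
rewrite -(ler_pM2r x2); apply: le_trans main _.
set q := (p * rho) ^+ k in kP *.
have q0 : 0 <= q by rewrite exprn_ge0.
have kq0 : 0 <= k%:R + n%:R * q by rewrite addr_ge0 // mulr_ge0 // ltW.
have MC : M * (k%:R + n%:R * q) <= C * n%:R * (k%:R + n%:R * q).
  by rewrite ler_wpM2r.
have := ler_wpM2r (ltW n0R) E5.
have nn : 0 <= n%:R * n%:R :> R by rewrite mulr_ge0.
have := ler_wpM2l nn kP.
by move: MC; rewrite exprMn !expr2; lra.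
Unshelve. all: by end_near. Qed.

Lemma supercritical_giant : mu / nu < p -> L1_giant perc d.
Proof.
have mu0 := mean_degree_gt0; have nu0 : 0 < nu := lt_trans mu0 mu_nu.
have [p0 p1] := andP p01.
move=> pmu; have pnu : mu < p * nu by rewrite -ltr_pdivrMr.
have p_gt0 : 0 < p by apply: lt_trans pmu; rewrite divr_gt0.
(* The gap to be shared out: the errors [e1], the loss [g] and the drift [k] use at most 9/32, 1/8
   and 1/4 of it in the drift condition. *)
pose x := p * nu - mu; have x0 : 0 < x by rewrite subr_gt0.
pose e1 := Num.min (x / 32) (mu / 8).
have e10 : 0 < e1 by rewrite lt_min !divr_gt0.
have e1x : e1 <= x / 32 by rewrite ge_min lexx.
have e1mu : e1 <= mu / 8 by rewrite ge_min lexx orbT.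
have mx0 : 0 < 2 * mu + x by rewrite addr_gt0 // mulr_gt0.
pose g := x / 8 / (2 * mu + x).
have g0 : 0 < g by rewrite !divr_gt0.
have gx : g * (2 * mu + x) = x / 8 by rewrite mulfVK // gt_eqF.
have g1 : g <= 1 by rewrite ler_pdivrMr //; lra.
pose k := Num.min (x / 8 / (mu + x)) (p / 2).
have k0 : 0 < k by rewrite lt_min !divr_gt0 // addr_gt0.
have kp : k <= p / 2 by rewrite ge_min lexx orbT.
have mux0 : 0 < mu + x by rewrite addr_gt0.
have kx : k * (mu + x) <= x / 8 by rewrite -(ler_pdivlMr _ _ mux0) ge_min lexx.
have [B BP] := uniformly_square_integrable d_sparse e10.
have B0 : 0 <= B%:R :> R by [].
have B20 : 0 < B%:R + 2 :> R by rewrite ltr_wpDl.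
have BB0 : 0 < B%:R ^+ 2 + 1 :> R by rewrite ltr_wpDl // sqr_ge0.
(* The exploration lasts about [s * n] steps: few enough that visited vertices carry little of the
   second moment and [M - (2 * T)%:R] stays above [mu / 2 * n%:R]. *)
pose s := Num.min (mu / 8) (e1 / (B%:R ^+ 2 + 1)).
have s0 : 0 < s by rewrite lt_min !divr_gt0.
have s_mu : s <= mu / 8 by rewrite ge_min lexx.
have sB : B%:R ^+ 2 * s <= e1.
  have : s * (B%:R ^+ 2 + 1) <= e1 by rewrite -ler_pdivlMr // ge_min lexx orbT.
  by move: s0; lra.
pose theta := Num.min (2^-1 / (B%:R + 2)) (k / (2 * (B%:R + 2) ^+ 2)).
have C20 : 0 < 2 * (B%:R + 2) ^+ 2 :> R by rewrite mulr_gt0 // exprn_gt0.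
have t0 : 0 < theta by rewrite lt_min !divr_gt0 // invr_gt0.
have tB : theta * (B%:R + 2) <= 2^-1 by rewrite -ler_pdivlMr // ge_min lexx.
have tk : theta * (2 * (B%:R + 2) ^+ 2) <= k.
  by rewrite -ler_pdivlMr // ge_min lexx orbT.
(* The target for the boundary is half of the total drift [k * s], so that [expR (theta * Y0%:R)]
   does not outweigh the contraction over [T] steps. *)
pose c := k * s / 2.
have c0 : 0 < c by rewrite divr_gt0 // mulr_gt0.
have c4 : 0 < c / 4 by rewrite divr_gt0.
have [B2 BP2] := uniformly_square_integrable d_sparse c4.
have BB20 : 0 < B2%:R ^+ 2 + 1 :> R by rewrite ltr_wpDl // sqr_ge0.
(* A component of at most [eps * n] vertices has total degree at most [c / 2 * n], below [Y0]. *)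
pose eps := c / 4 / (B2%:R ^+ 2 + 1).
have eps0 : 0 < eps by rewrite divr_gt0.
have epsB : B2%:R ^+ 2 * eps <= c / 4.
  have : eps * (B2%:R ^+ 2 + 1) = c / 4 by rewrite mulfVK // gt_eqF.
  by move: eps0; lra.
(* Absorbs the rounding of [T] and [Y0] to integers. *)
pose K := expR (theta * (1 + k)).
have K0 : 0 < K by exact: expR_gt0.
pose a := theta * (k * s / 2).
have a0 : 0 < a by rewrite mulr_gt0.
have gmu : 0 < g * (mu / 2) by rewrite mulr_gt0 // divr_gt0.
have gmu3 : 0 < g * (mu / 2) / 2 by rewrite divr_gt0.
exists eps => //; apply/cvgrPdist_le => e e0.
near=> n.
have n0 : (0 < n)%N by near: n; exists 1%N.
have n0R : 0 < n%:R :> R by rewrite ltr0n.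
have E1 : `|mu - (\sum_(v < n) tnth (d n) v)%:R / n%:R| <= e1.
  by near: n; move/cvgrPdist_le : cvg_mu; apply.
have E2 : `|nu - (\sum_(v < n) tnth (d n) v * (tnth (d n) v).-1)%:R / n%:R| <= e1.
  by near: n; move/cvgrPdist_le : cvg_nu; apply.
have E3 : (2 * ((max_degree (d n)).+2 * (max_degree (d n)).+2))%:R <= g * (mu / 2) / 2 * n%:R.
  by near: n; apply: max_degree_sqr_small.
have E4 : K / a <= e * n%:R.
  by rewrite [leRHS]mulrC -ler_pdivrMr //; near: n; apply: nbhs_infty_ger.
have E5 : tail_sqr R d n B <= e1 * n%:R by near: n.
have E6 : tail_sqr R d n B2 <= c / 4 * n%:R by near: n.
rewrite !ler_distl in E1 E2; move: E1 E2.
set M := (\sum_v _)%:R; set V := (\sum_v _ * _)%:R.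
move=> /andP[a1 a2] /andP[_ b2].
have M1 : (mu - e1) * n%:R <= M by rewrite -ler_pdivlMr //; lra.
have M2 : M <= (mu + e1) * n%:R by rewrite -ler_pdivrMr //; lra.
have V1 : (nu - e1) * n%:R <= V by rewrite -ler_pdivlMr //; lra.
pose T := Num.truncn (s * n%:R); pose Y0 := (Num.truncn (c * n%:R)).+1.
have sn0 : 0 <= s * n%:R by rewrite mulr_ge0 // ltW.
have cn0 : 0 <= c * n%:R by rewrite mulr_ge0 // ltW.
have T1 : T%:R <= s * n%:R by rewrite truncn_le.
have T2 : s * n%:R <= T%:R + 1 by rewrite natr1 ltW // truncnS_gt.
have Y1 : c * n%:R < Y0%:R by rewrite truncnS_gt.
have Y2 : Y0%:R <= c * n%:R + 1 by rewrite -natr1 lerD2r truncn_le.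
rewrite (prob_compl _ (@percE n) (graphs_of_gt0 n0)) opprB addrCA subrr addr0.
rewrite ger0_norm; last exact: (prob_ge0 _ _ p01 (@percE n)).
set A := predC _.
have smallA (E : graph n) v : A E -> (\sum_(u in component E v) tnth (d n) u < Y0)%N.
  rewrite /A /= -leNgt => L1E; rewrite -(ltr_nat R) natr_sum; apply: le_lt_trans Y1.
  have CE : #|component E v|%:R <= eps * n%:R.
    by apply: le_trans L1E; rewrite ler_nat leq_component_L1.
  have := sum_sqr_small E6 CE epsB => S2.
  apply: le_trans (_ : \sum_(w in component E v) (tnth (d n) w)%:R ^+ 2 <= _).
    by apply: ler_sum => u _; exact: ler_nat_sqr.
  by apply: le_trans S2 _; rewrite ler_wpM2r // ?ltW //; lra.
have m_mu : (mu / 2) * n%:R <= M - (2 * T)%:R.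
  have : (mu - e1 - 2 * s) * n%:R <= M - (2 * T)%:R.
    by rewrite natrM; lra.
  by apply: le_trans; rewrite ler_wpM2r ?(ltW n0R) //; lra.
have m_gt0 : 0 < M - (2 * T)%:R.
  by apply: lt_le_trans m_mu; rewrite mulr_gt0 // divr_gt0.
pose b := (1 - g) / ((mu + e1) * n%:R).
have me0 : 0 < (mu + e1) * n%:R by rewrite mulr_gt0 // addr_gt0.
have b0 : 0 <= b by rewrite divr_ge0 ?subr_ge0 // ltW.
have bM : b * M <= 1 - g.
  by rewrite mulrAC ler_pdivrMr // ler_wpM2l // subr_ge0.
have gm : (3 * ((max_degree (d n)).+2 * (max_degree (d n)).+2))%:R <= g * (M - (2 * T)%:R).
  apply: le_trans (_ : g * ((mu / 2) * n%:R) <= _); last by rewrite ler_wpM2l // ltW.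
  move: E3; rewrite !natrM; set D := (max_degree (d n)).+2%:R.
  by have : 0 <= D * D by [rewrite mulr_ge0]; lra.
have hW (W : {set 'I_n}) : (#|W| <= T)%N ->
    2 + 2 * k <= \sum_(w | w \notin W) (tnth (d n) w)%:R * b
     + p * \sum_(w | w \notin W) (tnth (d n) w)%:R * b * ((minn (tnth (d n) w) B)%:R - 1).
  move=> WT; have WT' : #|W|%:R <= s * n%:R by apply: le_trans T1; rewrite ler_nat.
  have S2 := sum_sqr_small E5 WT' sB.
  set Sq := \sum_(w in W) _ in S2.
  pose Q := \sum_(w | w \notin W) (tnth (d n) w)%:R : R.
  pose Z := \sum_(w | w \notin W) (tnth (d n) w)%:R * ((minn (tnth (d n) w) B)%:R - 1) : R.
  have -> : \sum_(w | w \notin W) (tnth (d n) w)%:R * b = b * Q.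
    by rewrite mulr_sumr; apply: eq_bigr => w _; rewrite mulrC.
  have -> : \sum_(w | w \notin W) (tnth (d n) w)%:R * b * ((minn (tnth (d n) w) B)%:R - 1) = b * Z.
    by rewrite mulr_sumr; apply: eq_bigr => w _; rewrite mulrA (mulrC b).
  have Q1 : M - Sq <= Q := sum_degree_outside _ _ W.
  have Z1 : V - Sq - tail_sqr R d n B <= Z := sum_truncated_outside _ _ W B.
  (* The sum [Q] loses [3 * e1]: one from [M] and two from the visited vertices. The sum [Z] loses
     [4 * e1], the tail being added; and [p <= 1]. *)
  have QZ : (2 * mu + x - 7 * e1) * n%:R <= Q + p * Z.
    have pV : p * ((nu - 4 * e1) * n%:R) <= p * Z.
      by rewrite ler_wpM2l //; move: V1 S2 E5 Z1; lra.
    have pe : p * (e1 * n%:R) <= e1 * n%:R.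
      by rewrite ler_piMl // mulr_ge0 // ltW.
    by move: M1 S2 Q1 pV pe; rewrite /x; lra.
  have bQZ := ler_wpM2l b0 QZ.
  have -> : b * Q + p * (b * Z) = b * (Q + p * Z) by ring.
  apply: le_trans bQZ; rewrite /b mulrAC ler_pdivlMr // !mulrA ler_wpM2r ?(ltW n0R) //.
  have ge1 : 0 <= g * e1 by rewrite mulr_ge0 // ltW.
  have ke1 : k * e1 <= k * x.
    by rewrite ler_wpM2l ?(ltW k0) //; move: e1x x0; lra.
  by move: gx kx e1x x0 ge1 ke1; lra.
have kp' : 0 <= k <= p / 2 by rewrite (ltW k0).
have bound := small_component_prob (FM n) (@percE n) (graphs_of_gt0 n0)
  (@degree_le_max n) (isT : 0 < Y0)%N smallA p01 (ltW t0) kp' tB tk b0 (ltW g0)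
  bM m_gt0 gm hW.
apply: le_trans bound _.
have kt0 : 0 <= 1 - k * theta.
  have : k * theta <= 1 * 1.
    by apply: ler_pM; rewrite ?ltW //; [move: kp p1|move: tB B0 t0]; nra.
  by lra.
apply: le_trans (_ : expR (theta * Y0%:R) * expR (- (k * theta)) ^+ T <= _).
  rewrite ler_wpM2l ?expR_ge0 // lerXn2r ?nnegrE ?expR_ge0 //.
  by have := expR_ge1Dx (- (k * theta)).
rewrite -expRM_natl -expRD.
apply: le_trans (_ : K * expR (- (a * n%:R)) <= _).
  rewrite /K -expRD ler_expR /a.
  have h1 : theta * Y0%:R <= theta * (c * n%:R + 1) by rewrite ler_wpM2l // ltW.
  have h2 : theta * k * (s * n%:R) <= theta * k * (T%:R + 1).
    by rewrite ler_wpM2l // mulr_ge0 // ltW.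
  by move: h1 h2; rewrite /c; lra.
have an0 : 0 < a * n%:R by rewrite mulr_gt0.
rewrite expRN ler_pdivrMr ?expR_gt0 //.
apply: le_trans (_ : e * (a * n%:R) <= _).
  by move: E4; rewrite ler_pdivrMr // => E4; move: E4; lra.
rewrite ler_wpM2l ?(ltW e0) //; apply: le_trans (expR_ge1Dx _).
by lra.
Unshelve. all: by end_near. Qed.

End Threshold.

Theorem theorem1p1 (R : realType) (d : forall n : nat, n.-tuple nat)
    (lam : nat -> R)
    (d_seq : asymptotic_degree_sequence d)
    (d_graphical : graphical d)
    (d_sparse : sparse d lam)
    (d_max : forall n : nat, (0 < n)%N ->
       (max_degree (d n))%:R <= n%:R `^ (1 / 9) :> R)
    (L_derivable : twice_left_derivable (generating_function lam) 1) :
  let dL := left_derive (generating_function lam) 1 in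
  let d2L := left_derive (left_derive (generating_function lam)) 1 in
  d2L > dL ->
  [/\ critical_prob (@site R) d = dL / d2L,
      critical_prob (@bond R) d = dL / d2L,
      forall p : R, critical_prob (@bond R) d < p <= 1 -> L1_giant (bond p) d
    & forall p : R, critical_prob (@site R) d < p <= 1 -> L1_giant (site p) d].
Proof.
move=> dL d2L dLd2L.
have [cM cV] := degree_moments d_sparse.
have dL0 : 0 < dL := mean_degree_gt0 d_sparse cM cV dLd2L.
have d2L0 : 0 < d2L := lt_trans dL0 dLd2L.
have c01 : 0 < dL / d2L < 1 by rewrite divr_gt0 //= ltr_pdivrMr // mul1r.
have siteE (p : R) n (G E : graph n) :
    site p G E = \sum_(S | site_graph G S == E) coin_weight p S := site_coins p G E.
have bondE (p : R) n (G E : graph n) :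
    bond p G E = \sum_(S | bond_graph G S == E) coin_weight p S := bond_coins p G E.
have siteC : critical_prob (@site R) d = dL / d2L.
  apply: critical_prob_eq => // p p01 pc.
    exact: (subcritical_negligible d_graphical d_sparse d_max cM cV dLd2L
      (fun n => @site_model n) (siteE p) p01 pc).
  exact: (supercritical_giant d_graphical d_sparse d_max cM cV dLd2L
      (fun n => @site_model n) (siteE p) p01 pc).
have bondC : critical_prob (@bond R) d = dL / d2L.
  apply: critical_prob_eq => // p p01 pc.
    exact: (subcritical_negligible d_graphical d_sparse d_max cM cV dLd2L
      (fun n => @bond_model n) (bondE p) p01 pc).
  exact: (supercritical_giant d_graphical d_sparse d_max cM cV dLd2L
      (fun n => @bond_model n) (bondE p) p01 pc).
split=> // p /andP[]; rewrite ?siteC ?bondC => pc p1.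
  have p01 : 0 <= p <= 1 by rewrite p1 andbT (le_trans _ (ltW pc)) // ltW //; case/andP: c01.
  exact: (supercritical_giant d_graphical d_sparse d_max cM cV dLd2L
      (fun n => @bond_model n) (bondE p) p01 pc).
have p01 : 0 <= p <= 1 by rewrite p1 andbT (le_trans _ (ltW pc)) // ltW //; case/andP: c01.
exact: (supercritical_giant d_graphical d_sparse d_max cM cV dLd2L
      (fun n => @site_model n) (siteE p) p01 pc).
Qed.
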